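(* In the Gaussian model described in the context, with unequal private-signal precisions $\tau_S\ne\tau_B$, $$\mathbb E[z-\mu\mid \text{trade}]=-\frac{\operatorname{Cov}(\theta,G)}{\sigma_G}\,\lambda(k).$$ The expression is zero in the symmetric benchmark $\tau_S=\tau_B$. Otherwise, its absolute value rises when extraction $a$ lowers $h$, holding the signal structure ($\tau,\tau_S,\tau_B,\tau_z$) fixed. A platform that applies the unselected Gaussian likelihood to traded outcomes (one that ignores the trading event) has a nonzero expected update error. A platform that conditions on the known trading rule (the event $G\le h$) removes this truncation error under the maintained model.
   Context: $\Phi$ and $\phi$ are the standard normal cdf and density. A latent common quality has public prior $\theta\sim N(\mu,\tau^{-1})$. The seller's agent ($S$) and the buyer's agent ($B$) observe private signals $\theta+\varepsilon_j$, with independent errors $\varepsilon_j\sim N(0,\tau_j^{-1})$, $j\in\{S,B\}$, independent of $\theta$. Their posterior means are $m^j=\dfrac{\tau\mu+\tau_j(\theta+\varepsilon_j)}{\tau+\tau_j}$. Let $w_j=\tau_j/(\tau+\tau_j)$ and $G=m^S-m^B$, so that $(\theta,G)$ is jointly normal with $$\operatorname{Cov}(\theta,G)=\frac{w_S-w_B}{\tau},\qquad \sigma_G^2=\operatorname{Var}(G)=\frac{(w_S-w_B)^2}{\tau}+\frac{w_S^2}{\tau_S}+\frac{w_B^2}{\tau_B}.$$ Trade is the event $\{G\le h\}$, where $h=\ell-\underline u-a-\chi r$, with $a\ge0$ the seller's extraction and $\ell>0$, $\underline u>0$, $\chi$, $r\ge0$ fixed constants (seller's surplus cushion, buyer's required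 surplus, trust-wedge coefficient, trust distance). Put $k=(h-\mathbb E[G])/\sigma_G$ and $\lambda(k)=\phi(k)/\Phi(k)$. If trade occurs, an outcome $z=\theta+\nu$ is observed, with $\nu\sim N(0,\tau_z^{-1})$ independent of the other variables; without trade there is no outcome. The unselected Gaussian likelihood treats a traded outcome $z$ as an ordinary $N(\theta,\tau_z^{-1})$ observation not subject to selection, giving the conjugate update with precision $\tau+\tau_z$ and mean $(\tau\mu+\tau_zz)/(\tau+\tau_z)$. A likelihood that conditions on the trading rule is the one conditional on $\{G\le h\}$. The maintained model is the joint-normal model just described. *)

(* Defs.v *)
From HB Require Import structures.
From mathcomp Require Import all_boot all_order all_algebra.
From mathcomp Require Import all_classical all_reals all_analysis.

Set Implicit Arguments.
Unset Strict Implicit.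
Unset Printing Implicit Defensive.
Import Order.TTheory GRing.Theory Num.Theory.
Import numFieldNormedType.Exports.
Local Open Scope classical_set_scope.
Local Open Scope ring_scope.

(* N(m, p^-1): the library parameterizes normal laws by the standard deviation,
   here p is a precision.  The laws are compared on measurable sets only. *)
Definition normal_law d (T : measurableType d) (R : realType)
    (P : probability T R) (X : T -> R) (m p : R) : Prop :=
  forall A : set R, measurable A ->
    P (X @^-1` A) = normal_prob m (Num.sqrt p^-1) A.

Definition mutually_independent d (T : measurableType d) (R : realType)
    (P : probability T R) (I : finType) (X : I -> T -> R) : Prop :=
  forall (J : {set I}) (B : I -> set R), (forall i, measurable (B i)) ->
    P (\bigcap_(i in [set` J]) (X i @^-1` B i)) =
    (\prod_(i in J) P (X i @^-1` B i))%E.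

(* E[X | A] = E[X 1_A] / P(A), for an event A. *)
Definition event_expectation d (T : measurableType d) (R : realType)
    (P : probability T R) (A : set T) (X : T -> R) : \bar R :=
  ((\int[P]_(w in A) (X w)%:E) * ((fine (P A))^-1)%:E)%E.

(* Constants of the model; the prior is theta ~ N(prior_mean, prior_prec^-1)
   and h = cushion - reserve - a - wedge * distance, where a is the extraction. *)
Record params (R : realType) := Params {
  prior_mean : R;  (* mu *)
  prior_prec : R;  (* tau *)
  precS : R;       (* tau_S *)
  precB : R;       (* tau_B *)
  precz : R;       (* tau_z *)
  cushion : R;     (* ell *)
  reserve : R;     (* underlined u *)
  wedge : R;       (* chi *)
  distance : R;    (* r *)
  prior_prec_gt0 : 0 < prior_prec;
  precS_gt0 : 0 < precS;
  precB_gt0 : 0 < precB;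
  precz_gt0 : 0 < precz;
  cushion_gt0 : 0 < cushion;
  reserve_gt0 : 0 < reserve;
  distance_ge0 : 0 <= distance
}.

Record gaussian_model d (T : measurableType d) (R : realType)
    (P : probability T R) (p : params R) := GaussianModel {
  theta : {RV P >-> R};
  epsS : {RV P >-> R};
  epsB : {RV P >-> R};
  nu : {RV P >-> R};
  theta_law : normal_law P theta (prior_mean p) (prior_prec p);
  epsS_law : normal_law P epsS 0 (precS p);
  epsB_law : normal_law P epsB 0 (precB p);
  nu_law : normal_law P nu 0 (precz p);
  shocks_independent :
    mutually_independent P (tnth [tuple (theta : T -> R); (epsS : T -> R);
                                        (epsB : T -> R); (nu : T -> R)])
}.

Section Signals.
Context (R : realType) (p : params R).

Definition agent_mean (prec x : R) : R :=
  (prior_prec p * prior_mean p + prec * x) / (prior_prec p + prec).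

(* m^S - m^B when the seller's agent sees xS and the buyer's agent sees xB. *)
Definition mean_gap (xS xB : R) : R :=
  agent_mean (precS p) xS - agent_mean (precB p) xB.

Definition threshold (a : R) : R :=
  cushion p - reserve p - a - wedge p * distance p.

End Signals.

Section Model.
Context d (T : measurableType d) (R : realType) (P : probability T R)
  (p : params R) (M : gaussian_model P p).

Definition gap (w : T) : R :=
  mean_gap p (theta M w + epsS M w) (theta M w + epsB M w).

Definition trade (a : R) : set T := [set w | gap w <= threshold p a].

Definition outcome (w : T) : R := theta M w + nu M w.

Definition sd_gap : R := Num.sqrt (fine 'V_P[gap]).

Definition std_threshold (a : R) : R :=
  (threshold p a - fine 'E_P[gap]) / sd_gap.

Definition mills (k : R) : R :=
  normal_pdf 0 1 k / fine (normal_prob 0 1 `]-oo, k]%classic).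

Definition selection_bias (a : R) : R :=
  - (fine (covariance P (theta M) gap) / sd_gap) * mills (std_threshold a).

Definition prior_pdf (t : R) : R :=
  normal_pdf (prior_mean p) (Num.sqrt (prior_prec p)^-1) t.

Definition outcome_pdf (t z : R) : R := normal_pdf t (Num.sqrt (precz p)^-1) z.

(* P(G <= h | theta = t): theta is independent of the signal errors, so the
   quality is frozen at t and only the errors remain random. *)
Definition trade_prob_at (a t : R) : R :=
  fine (P [set w | mean_gap p (t + epsS M w) (t + epsB M w) <= threshold p a]).

(* Joint density of (theta, z) used by a platform that ignores selection. *)
Definition unselected_joint (t z : R) : R := prior_pdf t * outcome_pdf t z.

(* Joint density of (theta, z) conditional on the event {G <= h}.  Selection
   enters through theta: given theta, z is independent of the trading event. *)
Definition selected_joint (a t z : R) : R :=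
  prior_pdf t * trade_prob_at a t * outcome_pdf t z / fine (P (trade a)).

Definition bayes_pdf (joint : R -> R -> R) (z t : R) : R :=
  joint t z / (\int[lebesgue_measure]_s joint s z).

Definition bayes_mean (joint : R -> R -> R) (z : R) : R :=
  \int[lebesgue_measure]_t (t * bayes_pdf joint z t).

(* Mean error, over traded outcomes, of the estimate u z of theta. *)
Definition expected_update_error (a : R) (u : R -> R) : \bar R :=
  event_expectation P (trade a) (fun w => u (outcome w) - theta M w).

End Model.

(* Main.v *)
(* The gap is [G = c theta + W] with [W] a normal noise independent of [theta], so
   the joint density of [(theta, G)] factors as the normal density of [G] times a
   normal density in [theta] whose mean is affine in [G] with slope
   [Cov(theta, G) / Var(G)].  Integrating over [G <= h], the truncated mean of
   [theta] reduces to that of [G], which is [- Var(G)] times the density of [G] at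
   [h]; since the outcome noise is independent of [G], this is the selection bias,
   and the estimates built from the unselected likelihood inherit it up to a
   nonzero factor.  The inverse Mills ratio decreases in [h] by the monotone
   likelihood ratio of the normal family.  Conditioning on the trading rule gives
   the conditional mean of [theta] under the density of [(theta, z)] restricted to
   trade, so its error integrates to zero by Fubini. *)

From HB Require Import structures.
Require Import Defs.
From mathcomp Require Import all_boot all_order all_algebra.
From mathcomp Require Import all_classical all_reals all_analysis.
From mathcomp Require Import measurable_realfun ring lra.
Import Order.TTheory GRing.Theory Num.Theory.
Import numFieldNormedType.Exports.
Local Open Scope classical_set_scope.
Local Open Scope ring_scope.

(** * Affine changes of variable and normal densities *)

Section LebesgueAffine.
Context {R : realType}.
Local Open Scope ereal_scope.
Local Notation leb := (@lebesgue_measure R).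

(** The model provides only marginal laws and the independence of four shocks, so every joint
    density has to be rebuilt: rectangles determine the law of a pair, independence makes it a
    product measure, and a shear of slope [c] carries the product density of [(X, Y)] to that of
    [(X, c X + Y)]. The same shear serves the signal errors, [(theta, G)], and [(theta, z)] with
    [c = 1]. Such identities are proved for nonnegative functions, where Tonelli applies directly,
    and then transferred to signed ones. One orthogonality fact carries both halves of the result:
    [x] minus its conditional mean given [g] integrates to zero. For the density of [(theta, G)] cut
    to [G <= h], the conditional mean is the affine regression, unaffected by a cut in [G] alone,
    and the residual drops out of the truncated mean. For the density of [(theta, z)] given trade,
    the cut enters as the weight [P(G <= h | theta)], the conditional mean is the posterior mean,
    and the residual is the update error up to sign. *)

Lemma measurable_affine (a b : R) :
  measurable_fun [set: R] (fun x : R => (a * x + b)%R).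
Proof. by apply: measurable_funD => //; exact: measurable_funM. Qed.

(** Uniqueness of Lebesgue measure: [|a|] times its image under [x -> a x + b] gives every half-open
    interval its length. *)
Lemma ge0_integral_affine (a b : R) (H : R -> \bar R) : a != 0%R ->
  measurable_fun [set: R] H -> (forall x, 0 <= H x) ->
  \int[leb]_y H y = `|a|%:E * \int[leb]_x H (a * x + b)%R.
Proof.
move=> a0 mH H0; pose phi := fun x : R => (a * x + b)%R.
have mphi : measurable_fun setT phi by exact: measurable_affine.
pose nn : {nonneg R} := NngNum (normr_ge0 a).
pose nu := @measure_function_pushforward__canonical__measure_function_Measure _ _
  (measurableTypeR R) (measurableTypeR R) R leb phi mphi.
transitivity (\int[mscale nn nu]_y H y); last first.
  rewrite ge0_integral_mscale// ge0_integral_pushforward//.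
apply: eq_measure_integral => A mA _.
apply: lebesgue_measure_unique => // X [[x y]/= _ <-].
rewrite /mscale/= /pushforward.
rewrite lebesgue_measure_itv/= lte_fin.
have [ap|an] := ltP 0%R a.
  rewrite (_ : phi @^-1` _ = `]((x - b) / a)%R, ((y - b) / a)%R]%classic); last first.
    apply/seteqP; split => z/=; rewrite !in_itv/= /phi ltr_pdivrMr// ler_pdivlMr//;
      by rewrite ltrBlDr lerBrDr mulrC.
  rewrite [lebesgue_measure _]lebesgue_measure_itv/= lte_fin ltr_pM2r ?invr_gt0// ltrD2r.
  case: ifPn; rewrite ?mule0// -!EFinD -EFinM gtr0_norm// => _.
  congr (_%:E); field; rewrite gt_eqF//.
have {}an : (a < 0)%R by rewrite lt_neqAle a0.
(* A negative [a] reverses the interval, closed on the left and open on the right, which its length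
   ignores. *)
rewrite (_ : phi @^-1` _ = `[((y - b) / a)%R, ((x - b) / a)%R[%classic); last first.
  apply/seteqP; split => z/=; rewrite !in_itv/= /phi ler_ndivrMr// ltr_ndivlMr//;
    by rewrite ltrBlDr lerBrDr (mulrC z) andbC.
rewrite [lebesgue_measure _]lebesgue_measure_itv/= lte_fin ltr_nM2r ?invr_lt0// ltrD2r.
case: ifPn; rewrite ?mule0// -!EFinD -EFinM ltr0_norm// => _.
congr (_%:E); field; rewrite lt_eqF//.
Qed.

(** A positive factor fixes both infinities, so signed integrals can be rescaled even when their
    parts are infinite. *)
Lemma gt0_muleBr (r : R) (x y : \bar R) : (0 < r)%R ->
  r%:E * (x - y) = r%:E * x - r%:E * y.
Proof.
move=> r0; case: x => [x||]; case: y => [y||].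
  by rewrite muleBr.
all: by rewrite /= ?gt0_muley ?gt0_muleNy ?lte_fin.
Qed.

Lemma integral_affine (a b : R) (H : R -> \bar R) : a != 0%R ->
  measurable_fun [set: R] H ->
  \int[leb]_y H y = `|a|%:E * \int[leb]_x H (a * x + b)%R.
Proof.
move=> a0 mH; rewrite integralE [X in _ * X]integralE.
rewrite (ge0_integral_affine a b _ a0 (measurable_funepos mH))//.
rewrite (ge0_integral_affine a b _ a0 (measurable_funeneg mH))//.
have aE : (0 < `|a|)%R by rewrite normr_gt0.
rewrite -gt0_muleBr//; congr (_ * (_ - _)); apply: eq_integral => x _.
  by rewrite [RHS](congr1 (@^~ x) (funepos_comp H (fun x => a * x + b)%R)).
by rewrite [RHS](congr1 (@^~ x) (funeneg_comp H (fun x => a * x + b)%R)).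
Qed.

Lemma integrable_affine (a b : R) (H : R -> \bar R) : a != 0%R ->
  measurable_fun [set: R] H ->
  leb.-integrable [set: R] (fun x : R => H (a * x + b)%R) ->
  leb.-integrable [set: R] H.
Proof.
move=> a0 mH /integrableP[_ iH]; apply/integrableP; split => //.
rewrite (ge0_integral_affine a b)//; last exact: measurableT_comp.
by rewrite lte_mul_pinfty.
Qed.
End LebesgueAffine.

(** The Radon-Nikodym derivative and [normal_pdf] have the same integral over every measurable set,
    hence agree almost everywhere. *)
Lemma ge0_integral_normal_prob {R : realType} (m s : R) (F : R -> \bar R) :
  measurable_fun [set: R] F -> (forall x, 0 <= F x)%E ->
  (\int[normal_prob m s]_x F x =
   \int[lebesgue_measure]_x (F x * (normal_pdf m s x)%:E))%E.
Proof.
move=> mF F0; have dom := @normal_prob_dominates R m s.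
rewrite -(Radon_Nikodym_SigmaFinite.change_of_variables dom)//=.
apply: ae_eq_integral => //.
- apply: emeasurable_funM => //; apply: (measurable_int lebesgue_measure).
  exact: Radon_Nikodym_SigmaFinite.f_integrable.
- apply: emeasurable_funM => //=; apply/measurableT_comp => //=.
  exact: measurable_normal_pdf.
apply: ae_eqe_mul2l => /=.
apply: integral_ae_eq => //=.
- exact: Radon_Nikodym_SigmaFinite.f_integrable.
- by apply/measurableT_comp => //; exact: measurable_normal_pdf.
- by move=> E _ mE; rewrite -Radon_Nikodym_SigmaFinite.f_integral.
Qed.

Section NormalDensity.
Context {R : realType}.
Local Notation leb := (@lebesgue_measure R).

Lemma normal_pdf_affine (m s a b x : R) : a != 0 -> s != 0 ->
  normal_pdf (a * m + b) (`|a| * s) (a * x + b) = `|a|^-1 * normal_pdf m s x.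
Proof.
move=> a0 s0; have na0 : `|a| != 0 by rewrite normr_eq0.
rewrite !normal_pdfE ?mulf_neq0//= mulrA; congr (_ * _).
  rewrite /normal_peak exprMn -mulrA -mulrnAr.
  by rewrite sqrtrM ?sqr_ge0// sqrtr_sqr normr_id invfM.
rewrite /normal_fun; congr expR; rewrite exprMn real_normK ?num_real//.
by field; rewrite s0 a0.
Qed.

Lemma normal_pdf_gt0 (m s x : R) : s != 0 -> 0 < normal_pdf m s x.
Proof. by move=> s0; rewrite normal_pdfE// mulr_gt0 ?normal_peak_gt0 ?expR_gt0. Qed.

Lemma normal_pdf0N (s x : R) : s != 0 -> normal_pdf 0 s (- x) = normal_pdf 0 s x.
Proof. by move=> s0; rewrite !normal_pdfE// /normal_fun !subr0 sqrrN. Qed.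

Lemma normal_pdf_center (m s x : R) : s != 0 ->
  normal_pdf m s (x + m) = normal_pdf 0 s x.
Proof. by move=> s0; rewrite !normal_pdfE// /normal_fun subr0 addrK. Qed.

(** This antiderivative is the source of every tail and truncated moment below. *)
Lemma is_derive_normal_pdf0 (s x : R) : s != 0 ->
  is_derive x 1 (fun y : R => - s ^+ 2 * normal_pdf 0 s y) (x * normal_pdf 0 s x).
Proof.
move=> s0; rewrite normal_pdfE//= /normal_fun.
rewrite (_ : (fun y => _) =
   (fun y : R => (- s ^+ 2 * normal_peak s) * expR (- y ^+ 2 / (s ^+ 2 *+ 2)))); last first.
  by apply/funext => y; rewrite subr0 mulrA.
apply: is_derive_eq.
rewrite subr0 /GRing.scale/= mulr1.
by field; rewrite s0.
Qed.

Lemma cvg_normal_pdf0 (s : R) : s != 0 -> normal_pdf 0 s x @[x --> +oo] --> (0 : R).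
Proof.
move=> s0; rewrite normal_pdfE//= -[X in _ --> X](mulr0 (normal_peak s)).
apply: cvgM; first exact: cvg_cst.
rewrite /normal_fun; under eq_cvg do rewrite subr0 mulNr.
apply: (cvg_comp (fun x => x ^+ 2 / (s ^+ 2 *+ 2)) (fun x => expR (- x)));
  last exact: cvgr_expR.
apply: gt0_cvgMly; last exact: cvgr_expr2.
by rewrite invr_gt0 pmulrn_lgt0// exprn_even_gt0.
Qed.

Lemma ge0_integral_normal_tail (s c : R) : s != 0 -> 0 <= c ->
  (\int[leb]_(x in `[c, +oo[) (x * normal_pdf 0 s x)%:E =
   (s ^+ 2 * normal_pdf 0 s c)%:E)%E.
Proof.
move=> s0 c0.
have cf : continuous (fun x : R => x * normal_pdf 0 s x).
  by move=> x; apply: cvgM; [exact: cvg_id|exact: continuous_normal_pdf].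
have cF : continuous (fun y : R => - s ^+ 2 * normal_pdf 0 s y).
  by move=> x; apply: cvgM; [exact: cvg_cst|exact: continuous_normal_pdf].
rewrite (@ge0_continuous_FTC2y _ _ (fun y : R => - s ^+ 2 * normal_pdf 0 s y) _ 0).
- by rewrite sub0e mulNr EFinN oppeK.
- by move=> x cx; rewrite mulr_ge0 ?normal_pdf_ge0// (le_trans c0).
- exact: continuous_subspaceT.
- rewrite -[X in _ --> X](mulr0 (- s ^+ 2)).
  by apply: cvgM; [exact: cvg_cst|exact: cvg_normal_pdf0].
- by move=> x _; apply: ex_derive; exact: is_derive_normal_pdf0.
- by apply: cvg_at_right_filter; exact: cF.
- move=> x _; rewrite derive1E; apply: derive_val; exact: is_derive_normal_pdf0.
Qed.


Lemma integrable_normal_moment1 (s : R) : s != 0 ->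
  leb.-integrable [set: R] (fun x : R => (x * normal_pdf 0 s x)%:E).
Proof.
move=> s0; apply/integrableP; split.
  by apply/measurable_EFinP/measurable_funM => //; exact: measurable_normal_pdf.
under eq_integral do rewrite /= normrM [`|normal_pdf _ _ _|]ger0_norm ?normal_pdf_ge0//.
rewrite ge0_symfun_integralT.
- rewrite (_ : [set x | _] = `[0, +oo[%classic); last first.
    by apply/seteqP; split => x/=; rewrite in_itv/= andbT.
  under eq_integral => x.
    rewrite inE/= in_itv/= andbT => x0; rewrite ger0_norm//.
    over.
  by rewrite ge0_integral_normal_tail// -EFinM ltry.
- by move=> x; rewrite mulr_ge0 ?normal_pdf_ge0.
- move=> x; apply: cvgM; last exact: continuous_normal_pdf.
  exact: norm_continuous.
- by move=> x /=; rewrite normrN normal_pdf0N.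
Qed.

(** The substitution [x -> - x] makes the integral equal to its opposite; being finite, it is
    zero. *)
Lemma integral_normal_moment1 (s : R) : s != 0 ->
  (\int[leb]_x (x * normal_pdf 0 s x)%:E = 0)%E.
Proof.
move=> s0; have im := integrable_normal_moment1 s s0.
have e : (\int[leb]_x (x * normal_pdf 0 s x)%:E =
          - \int[leb]_x (x * normal_pdf 0 s x)%:E)%E.
  rewrite [LHS](integral_affine (-1) 0) ?oppr_eq0 ?oner_eq0//; last first.
    exact: measurable_int im.
  rewrite normrN1 mul1e -integralN/=; last by rewrite integrable_add_def.
  by apply: eq_integral => x _; rewrite addr0 mulN1r normal_pdf0N// mulNr EFinN.
have := integrable_fin_num measurableT im.
by move: e; case: (integral _ _ _) => // r [] re _; congr EFin; lra.
Qed.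

(** For [0 <= h] the head complements a tail in a zero total; for [h < 0] reflection maps it to the
    tail beyond [- h]. *)
Lemma integral_normal_head (s h : R) : s != 0 ->
  (\int[leb]_(x in `]-oo, h]) (x * normal_pdf 0 s x)%:E =
   (- s ^+ 2 * normal_pdf 0 s h)%:E)%E.
Proof.
move=> s0; have im := integrable_normal_moment1 s s0.
have [h0|h0] := leP 0 h.
  have imS D : measurable D -> leb.-integrable D (fun x : R => (x * normal_pdf 0 s x)%:E).
    by move=> mD; exact: integrableS im.
  have := integral_normal_moment1 s s0.
  rewrite -(setUv `]-oo, h]%classic) integral_setU_EFin//=; last 3 first.
  - exact: measurableC.
  - by rewrite setUv; apply/measurable_EFinP; exact: measurable_int im.
  - by apply/disj_setPS; rewrite setICr.
  rewrite setCitvl integral_itv_obnd_cbnd; last first.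
    by apply: (measurable_int leb); exact: imS.
  rewrite ge0_integral_normal_tail//.
  have := integrable_fin_num _ (imS _ (measurable_itv `]-oo, h])).
  move=> /(_ (measurable_itv _)).
  case: (integral _ _ _) => // r _ [] re; congr EFin; lra.
rewrite integral_mkcond (integral_affine (-1) 0) ?oppr_eq0 ?oner_eq0//; last first.
  apply/(measurable_restrictT _ _).1 => //; apply: measurable_funTS.
  exact: measurable_int im.
rewrite normrN1 mul1e.
transitivity (- \int[leb]_(x in `[(- h)%R, +oo[) (x * normal_pdf 0 s x)%:E)%E; last first.
  rewrite ge0_integral_normal_tail// ?oppr_ge0 1?ltW//.
  by rewrite normal_pdf0N// mulNr.
rewrite [X in (- X)%E]integral_mkcond -integralN/=; last first.
  rewrite integrable_add_def//; apply: (integrable_mkcond _ _).1 => //.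
  apply: (@integrableS _ _ _ leb setT) => //.
apply: eq_integral => x _; rewrite !patchE addr0 mulN1r !mem_setE !in_itv/= andbT lerNl.
by case: ifP => _; rewrite ?oppe0// normal_pdf0N// mulNr EFinN.
Qed.

End NormalDensity.

(** * Moments of normal laws and truncation to a half-line *)

Section NormalMoments.
Context {R : realType}.
Local Notation leb := (@lebesgue_measure R).

(* Layer cake: [x ^ 2] is the integral of [x] over [0 <= y <= x], so Tonelli
   reduces the second moment to the tail integrals of [x * normal_pdf 0 s x]. *)
Lemma integral_normal_moment2 (s : R) : s != 0 ->
  (\int[leb]_x (x ^+ 2 * normal_pdf 0 s x)%:E = (s ^+ 2)%:E)%E.
Proof.
move=> s0.
have cf : continuous (fun x : R => x ^+ 2 * normal_pdf 0 s x).
  by move=> x; apply: cvgM; [exact: sqr_continuous|exact: continuous_normal_pdf].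
have e0 : [set x : R | 0 <= x] = `[0, +oo[%classic.
  by apply/seteqP; split => x/=; rewrite in_itv/= andbT.
rewrite ge0_symfun_integralT//; last 2 first.
  by move=> x; rewrite mulr_ge0 ?normal_pdf_ge0 ?sqr_ge0.
  by move=> x /=; rewrite sqrrN normal_pdf0N.
pose K (z : R * R) := if (0 <= z.2) && (z.2 <= z.1)
  then (z.1 * normal_pdf 0 s z.1)%:E else 0%E.
have mK : measurable_fun [set: R * R] K.
  apply: measurable_fun_ifT => //.
    by apply: measurable_and; apply: measurable_fun_ler.
  apply/measurable_EFinP/measurable_funM => //.
  apply: measurableT_comp => //; exact: measurable_normal_pdf.
have K0 z : (0 <= K z)%E.
  rewrite /K; case: ifPn => // /andP[z0 zz].
  by rewrite lee_fin mulr_ge0 ?normal_pdf_ge0// (le_trans z0).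
have inner (x : R) : (\int[leb]_y K (x, y) =
    if (0 <= x)%R then (x ^+ 2 * normal_pdf 0 s x)%:E else 0)%E.
  have lE : lebesgue_measure (`[0, x]%classic : set R) = (if (0 < x)%R then x%:E else 0)%E.
    by rewrite lebesgue_measure_itv/= lte_fin sube0.
  transitivity (\int[leb]_(y in `[0%R, x]) (x * normal_pdf 0 s x)%:E)%E.
    rewrite [RHS]integral_mkcond; apply: eq_integral => y _.
    by rewrite patchE mem_setE in_itv.
  transitivity ((x * normal_pdf 0 s x)%:E * (if (0 < x)%R then x%:E else 0))%E.
    by rewrite -lE; exact: (integral_cst leb (measurable_itv _)).
  have [x0|x0] := ltP 0 x.
    by rewrite (ltW x0) -EFinM expr2 mulrAC.
  rewrite mule0; case: ifP => // xge; have -> : x = 0 by apply/le_anti/andP.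
  by rewrite expr0n mul0r.
rewrite (_ : integral _ _ _ = \int[leb]_x \int[leb]_y K (x, y))%E; last first.
  rewrite integral_mkcond; apply: eq_integral => x _.
  by rewrite inner patchE mem_setE.
have /= tonelli := @fubini_tonelli _ _ _ _ _ leb leb K mK K0.
rewrite tonelli {tonelli}.
(* Evenness also halves the total mass, which cancels the factor 2 left by the reduction to
   [0 <= x]. *)
have pdf2 := @ge0_symfun_integralT R (normal_pdf 0 s) (normal_pdf_ge0 _ _)
  (@continuous_normal_pdf R 0 s s0) (fun x => esym (normal_pdf0N s x s0)).
rewrite integral_normal_pdf in pdf2.
rewrite (_ : integral _ _ _ = (s ^+ 2)%:E *
    \int[leb]_(y in [set x | 0 <= x]%R) (normal_pdf 0 s y)%:E)%E.
  by rewrite muleCA -pdf2 mule1.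
clear pdf2.
rewrite -ge0_integralZl_EFin ?sqr_ge0//=; last 3 first.
- by rewrite e0.
- by move=> x _; rewrite lee_fin normal_pdf_ge0.
- by apply/measurable_EFinP/measurable_funTS; exact: measurable_normal_pdf.
rewrite [RHS]integral_mkcond; apply: eq_integral => y _.
rewrite patchE; have [y0|y0] := leP 0 y; last first.
  rewrite memNset/=; last by rewrite leNgt y0.
  by rewrite integral0_eq// => x _; rewrite /K/= leNgt y0.
rewrite mem_set//.
rewrite -EFinM -ge0_integral_normal_tail// [RHS]integral_mkcond.
apply: eq_integral => x _.
by rewrite patchE mem_setE in_itv/= andbT /K/= y0.
Qed.

Lemma integral_normal_mean (m s : R) : s != 0 ->
  leb.-integrable [set: R] (fun x : R => (x * normal_pdf m s x)%:E) /\
  (\int[leb]_x (x * normal_pdf m s x)%:E = m%:E)%E.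
Proof.
move=> s0; pose H := fun x : R => (x * normal_pdf m s x)%:E.
have mf : measurable_fun [set: R] H.
  by apply/measurable_EFinP/measurable_funM => //; exact: measurable_normal_pdf.
pose G := fun x : R => ((x * normal_pdf 0 s x)%:E + m%:E * (normal_pdf 0 s x)%:E)%E.
have fE x : H (1 * x + m) = G x.
  by rewrite /H mul1r normal_pdf_center// mulrDl EFinD EFinM.
have i1 := integrable_normal_moment1 s s0.
have i2 : leb.-integrable [set: R] (fun x : R => (normal_pdf 0 s x)%:E).
  exact: integrable_normal_pdf.
have i0 : leb.-integrable [set: R] (fun x : R => (m%:E * (normal_pdf 0 s x)%:E)%E).
  exact: (integrableZl measurableT).
have iG : leb.-integrable [set: R] G by exact: (integrableD measurableT).
split.
  apply: (@integrable_affine _ 1 m H (oner_neq0 R) mf).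
  rewrite (_ : (fun x => _) = G)//; apply/funext => x; exact: fE.
rewrite (@integral_affine _ 1 m H (oner_neq0 R) mf).
rewrite normr1 mul1e; under eq_integral do rewrite fE.
rewrite (integralD measurableT i1 i0) (integralZl measurableT i2).
by rewrite integral_normal_moment1// add0e integral_normal_pdf mule1.
Qed.

Lemma integral_normal_variance (m s : R) : s != 0 ->
  (\int[leb]_x ((x - m) ^+ 2 * normal_pdf m s x)%:E = (s ^+ 2)%:E)%E.
Proof.
move=> s0; rewrite (integral_affine 1 m) ?oner_eq0//; last first.
  apply/measurable_EFinP/measurable_funM; last exact: measurable_normal_pdf.
  by apply: measurable_funX; exact: measurable_funB.
rewrite normr1 mul1e -integral_normal_moment2//; apply: eq_integral => x _.
by rewrite mul1r normal_pdf_center// addrK.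
Qed.

Lemma integral_normal_truncated_mean (m s h : R) : s != 0 ->
  (\int[leb]_(x in `]-oo, h]) ((x - m) * normal_pdf m s x)%:E =
   (- s ^+ 2 * normal_pdf m s h)%:E)%E.
Proof.
move=> s0; rewrite integral_mkcond (integral_affine 1 m) ?oner_eq0//; last first.
  apply/(measurable_restrictT _ _).1 => //; apply: measurable_funTS.
  apply/measurable_EFinP/measurable_funM; last exact: measurable_normal_pdf.
  exact: measurable_funB.
rewrite normr1 mul1e -[in RHS](subrK m h) normal_pdf_center//.
rewrite -integral_normal_head// [RHS]integral_mkcond; apply: eq_integral => x _.
by rewrite !patchE !mem_setE !in_itv/= mul1r normal_pdf_center// addrK lerBrDr.
Qed.

End NormalMoments.

(** * Products of normal densities and the inverse Mills ratio *)

Section NormalProduct.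
Context {R : realType}.
Local Notation leb := (@lebesgue_measure R).

(* The joint density of [(X, c X + Y)] at [(x, g)], factored as the density of
   the second coordinate times the conditional density of the first one. *)
Lemma normal_pdf_product (m1 m2 s1 s2 c S x g : R) :
  s1 != 0 -> s2 != 0 -> S != 0 -> S ^+ 2 = c ^+ 2 * s1 ^+ 2 + s2 ^+ 2 ->
  normal_pdf m1 s1 x * normal_pdf m2 s2 (g - c * x) =
  normal_pdf (c * m1 + m2) S g *
  normal_pdf (m1 + c * s1 ^+ 2 / S ^+ 2 * (g - (c * m1 + m2))) (s1 * s2 / S) x.
Proof.
move=> s10 s20 S0 SE.
rewrite !normal_pdfE ?mulf_neq0 ?invr_neq0//= !(mulrACA _ (normal_fun _ _ _)).
congr (_ * _).
  have h (t : R) : 0 <= t ^+ 2 * pi *+ 2 by rewrite mulrn_wge0// mulr_ge0 ?sqr_ge0 ?pi_ge0.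
  rewrite /normal_peak -!invfM -!(sqrtrM _ (h _)).
  by congr (Num.sqrt _)^-1; field.
rewrite /normal_fun.
rewrite -[LHS]expRD -[RHS]expRD; congr expR.
have SE0 : c ^+ 2 * s1 ^+ 2 + s2 ^+ 2 != 0 by rewrite -SE expf_eq0.
rewrite !exprMn exprVn SE; field.
by rewrite exprMn s10 s20 SE0.
Qed.

(** A zero integral would force [f] to vanish almost everywhere on a half-line of infinite
    measure. *)
Lemma integral_gt0_itvNyo (k : R) (f : R -> R) : measurable_fun [set: R] f ->
  (forall x, x < k -> 0 < f x) -> (0 < \int[leb]_(x in `]-oo, k[) (f x)%:E)%E.
Proof.
move=> mf f0; rewrite lt_neqAle; apply/andP; split; last first.
  by apply: integral_ge0 => x/=; rewrite in_itv/= => xk; rewrite lee_fin ltW ?f0.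
apply/negP => /eqP f_eq0.
have mfE : measurable_fun `]-oo, k[%classic (EFin \o f).
  by apply/measurable_funTS/measurable_EFinP.
have : (\int[leb]_(x in `]-oo, k[) `|(f x)%:E| = 0)%E.
  rewrite [RHS]f_eq0; apply: eq_integral => x; rewrite inE/= in_itv/= => xk.
  by rewrite ger0_norm// ltW ?f0.
move/(ae_eq_integral_abs leb (measurable_itv _) mfE) => -[N [mN N0 sub]].
have : (leb `]-oo, k[ <= leb N)%E.
  apply: le_measure; rewrite ?inE// => x /= xk; apply: sub => /= /(_ xk) [].
  by apply/eqP; rewrite gt_eqF// f0// -[x < k]/(x \in `]-oo, k[).
by rewrite N0 lebesgue_measure_itv/= ltNyr.
Qed.

Local Notation f := (normal_pdf (0 : R) 1).
Local Notation Phi k := (fine (normal_prob (0 : R) 1 `]-oo, k]%classic)).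

Lemma normal_cdf_fin (m s k : R) :
  (fine (normal_prob m s `]-oo, k]%classic))%:E =
  (\int[leb]_(x in `]-oo, k]) (normal_pdf m s x)%:E)%E.
Proof. by rewrite fineK// fin_num_measure. Qed.

Lemma normal_cdf_gt0 (m s k : R) : s != 0 ->
  0 < fine (normal_prob m s `]-oo, k]%classic).
Proof.
move=> s0; rewrite -lte_fin normal_cdf_fin -integral_itv_bndo_bndc; last first.
  by apply/measurable_EFinP/measurable_funTS; exact: measurable_normal_pdf.
apply: integral_gt0_itvNyo; first exact: measurable_normal_pdf.
by move=> x _; exact: normal_pdf_gt0.
Qed.

Lemma normal_pdf_likelihood_ratio (k d y : R) : 0 < d -> y < k ->
  f k * f (y - d) < f (k - d) * f y.
Proof.
move=> d0 yk; have o0 := oner_neq0 R.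
rewrite !normal_pdfE//= !(mulrACA _ (normal_fun _ _ _)) ltr_pM2l; last first.
  by rewrite mulr_gt0// normal_peak_gt0.
rewrite /normal_fun -!expRD ltr_expR expr1n !subr0 -!mulrDl ltr_pM2r ?invr_gt0//.
have : 0 < d * (k - y) by rewrite mulr_gt0// subr_gt0.
nra.
Qed.

Lemma normal_cdf_shift (k d : R) :
  (Phi (k - d))%:E = (\int[leb]_(y in `]-oo, k]) (f (y - d))%:E)%E.
Proof.
have mf := @measurable_normal_pdf R 0 1.
rewrite normal_cdf_fin integral_mkcond (@integral_affine _ 1 (- d)) ?oner_neq0//; last first.
  by apply/(measurable_restrictT _ _).1 => //; apply/measurable_funTS/measurable_EFinP.
rewrite normr1 mul1e [RHS]integral_mkcond; apply: eq_integral => y _.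
by rewrite !patchE !mem_setE !in_itv/= mul1r lerD2r.
Qed.

(* Shifting both distribution functions to the same half-line turns the claim
   into the monotone likelihood ratio of the normal family. *)
Lemma mills_decreasing (k1 k2 : R) : k1 < k2 -> mills k2 < mills k1.
Proof.
move=> k12; have o0 := oner_neq0 R; rewrite /mills.
rewrite ltr_pdivrMr ?normal_cdf_gt0// mulrAC ltr_pdivlMr ?normal_cdf_gt0//.
set d := k2 - k1; have d0 : 0 < d by rewrite subr_gt0.
have k1E : k1 = k2 - d by rewrite /d subKr.
rewrite k1E -subr_gt0 -lte_fin EFinB !EFinM normal_cdf_shift normal_cdf_fin.
have mf := @measurable_normal_pdf R 0 1.
have mfd : measurable_fun [set: R] (fun y : R => f (y - d)).
  by apply: measurableT_comp => //; exact: measurable_funB.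
rewrite -!ge0_integralZl_EFin ?normal_pdf_ge0//;
  try by move=> x _; rewrite lee_fin normal_pdf_ge0.
all: try by apply/measurable_EFinP/measurable_funTS.
have ipdf (g : R -> R) (r : R) : measurable_fun [set: R] g -> (forall x, 0 <= g x) ->
    (\int[leb]_(x in `]-oo, k2]) (g x)%:E \is a fin_num)%E ->
    leb.-integrable `]-oo, k2]%classic (fun x => (r%:E * (g x)%:E)%E).
  move=> mg g0 gfin.
  have ig : leb.-integrable `]-oo, k2]%classic (fun x : R => (g x)%:E).
  apply/integrableP; split; first exact/measurable_EFinP/measurable_funTS.
  under eq_integral do rewrite /= ger0_norm//.
  by rewrite ltey_eq gfin.
  exact: (@integrableZl _ _ _ leb _ (measurable_itv _) r _ ig).
rewrite -(@integralB _ _ _ leb _ (measurable_itv _)); last 2 first.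
- by apply: ipdf => // [x|]; rewrite ?normal_pdf_ge0// -normal_cdf_fin.
- by apply: ipdf => // [x|]; rewrite ?normal_pdf_ge0// -normal_cdf_shift.
have mg : measurable_fun [set: R] (fun x => f (k2 - d) * f x - f k2 * f (x - d)).
  by apply: measurable_funB; exact: measurable_funM.
under eq_integral do rewrite -!EFinM -EFinB.
(* The integrand vanishes at the endpoint [k2], so strict positivity is available only on the open
   half-line. *)
rewrite -integral_itv_bndo_bndc; last exact/measurable_EFinP/measurable_funTS.
apply: integral_gt0_itvNyo => // x xk.
by rewrite subr_gt0 normal_pdf_likelihood_ratio.
Qed.
End NormalProduct.

(** * Independence and joint laws *)

Section Independence.
Context {d d1 d2} {T : measurableType d} {T1 : measurableType d1}
  {T2 : measurableType d2} {R : realType} (P : probability T R).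
Local Open Scope ereal_scope.

(** The codomains are arbitrary so that either side may itself be a pair of variables. *)
Definition independent_pair (X : T -> T1) (Y : T -> T2) :=
  forall A B, measurable A -> measurable B ->
    P (X @^-1` A `&` Y @^-1` B) = P (X @^-1` A) * P (Y @^-1` B).

Variables (X : {RV P >-> T1}) (Y : {RV P >-> T2}).

Let mXY : measurable_fun [set: T] (fun w => (X w, Y w)).
Proof. by apply: measurable_fun_pair. Qed.

Definition pair_RV : {RV P >-> (T1 * T2)%type} :=
  HB.pack (fun w => (X w, Y w)) (isMeasurableFun.Build _ _ _ _ _ mXY).

(** Both sides are finite measures in [S] that agree on rectangles, a pi-system generating the
    product sigma-algebra. *)
Lemma pair_event_independent (E : set T) : measurable E ->
  (forall A B, measurable A -> measurable B ->
    P (X @^-1` A `&` Y @^-1` B `&` E) = P (X @^-1` A `&` Y @^-1` B) * P E) ->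
  forall S, measurable S -> P (pair_RV @^-1` S `&` E) = P (pair_RV @^-1` S) * P E.
Proof.
move=> mE PE S mS.
have PEfin : P E \is a fin_num by exact: fin_num_measure.
pose r : {nonneg R} := NngNum (fine_ge0 (measure_ge0 P E)).
pose m1 := @measure_function_pushforward__canonical__measure_function_Measure _ _
  T (T1 * T2)%type R (mrestr P mE) pair_RV mXY.
pose m2 := mscale r (distribution P pair_RV).
have rE : (r%:num)%:E = P E by rewrite /= fineK.
rewrite muleC -rE -[LHS]/(m1 S) -[RHS]/(m2 S).
apply: (measure_unique [set A `*` B | A in measurable & B in measurable] (fun=> setT)).
- exact: measurable_prod_measurableType.
- move=> _ _ [A mA [B mB <-]] [A' mA' [B' mB' <-]].
  rewrite -setXI; exists (A `&` A'); first exact: measurableI.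
  by exists (B `&` B') => //; exact: measurableI.
- by move=> _; exists setT => //; exists setT => //; rewrite setXTT.
- by rewrite bigcup_const.
- move=> _ [A mA [B mB <-]].
  rewrite -[RHS]/((r%:num)%:E * P (X @^-1` A `&` Y @^-1` B)) rE [RHS]muleC.
  exact: PE.
- move=> _; rewrite -[X in X < _]/(P (setT `&` E)) setTI.
  by rewrite (le_lt_trans (probability_le1 P mE))// ltry.
- exact: mS.
Qed.

(** Independence identifies the joint law with the product of the marginal laws, to which Tonelli
    applies. *)
Lemma ge0_integral_independent (F : T1 * T2 -> \bar R) : independent_pair X Y ->
  measurable_fun [set: T1 * T2] F -> (forall z, 0 <= F z) ->
  \int[P]_w F (X w, Y w) =
  \int[distribution P X]_x \int[distribution P Y]_y F (x, y).
Proof.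
move=> XY mF F0; rewrite -fubini_tonelli1//.
transitivity (\int[distribution P pair_RV]_z F z).
  by rewrite ge0_integral_distribution.
apply: eq_measure_integral => S mS _; apply/esym.
by apply: product_measure_unique => // A B mA mB; exact: XY.
Qed.

End Independence.

(* An equality of integrals of nonnegative functions extends to signed ones with
   no integrability assumption, since [integral] is defined as the difference of
   the integrals of the positive and negative parts. *)
Section Transfer.
Context d d' (T : measurableType d) (T' : measurableType d') (R : realType)
  (mu : {measure set T -> \bar R}) (nu : {measure set T' -> \bar R})
  (phi : T -> T') (a : T -> R) (k : T' -> R).
Local Open Scope ereal_scope.
Hypotheses (a0 : forall w, (0 <= a w)%R) (k0 : forall z, (0 <= k z)%R).
Hypothesis ge0_transfer : forall G : T' -> \bar R, measurable_fun setT G ->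
  (forall z, 0 <= G z) ->
  \int[mu]_w (G (phi w) * (a w)%:E) = \int[nu]_z (G z * (k z)%:E).

Lemma funeposM_ge0 (S : Type) (F b : S -> R) : (forall x, (0 <= b x)%R) ->
  (fun x => (F x * b x)%:E)^\+ = (fun x => (EFin \o F)^\+ x * (b x)%:E).
Proof.
move=> b0; apply/funext => x; rewrite !funeposE/= -!EFin_max -EFinM; congr EFin.
by rewrite -[in LHS](mul0r (b x)) maxr_pMl.
Qed.

Lemma funenegM_ge0 (S : Type) (F b : S -> R) : (forall x, (0 <= b x)%R) ->
  (fun x => (F x * b x)%:E)^\- = (fun x => (EFin \o F)^\- x * (b x)%:E).
Proof.
move=> b0; apply/funext => x; rewrite !funenegE/= -!EFin_max -EFinM; congr EFin.
by rewrite -[in LHS](mul0r (b x)) -mulNr maxr_pMl.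
Qed.

(** In the applications [a] is the constant 1 or the indicator of trade, and [k] is the density of
    [phi] under that weight. *)
Lemma integral_transfer (F : T' -> R) : measurable_fun setT F ->
  \int[mu]_w (F (phi w) * a w)%:E = \int[nu]_z (F z * k z)%:E.
Proof.
move=> mF; rewrite integralE [RHS]integralE.
rewrite (funeposM_ge0 _ (F \o phi) a)// (funenegM_ge0 _ (F \o phi) a)//.
rewrite (funeposM_ge0 _ F k)// (funenegM_ge0 _ F k)//.
have mEF : measurable_fun setT (EFin \o F) by exact/measurable_EFinP.
rewrite -(ge0_transfer _ (measurable_funepos mEF))//.
rewrite -(ge0_transfer _ (measurable_funeneg mEF))//.
by congr (_ - _); apply: eq_integral => w _; rewrite ?funeposE ?funenegE.
Qed.

Lemma integrable_transfer (F : T' -> R) : measurable_fun setT F ->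
  measurable_fun setT (fun w => (F (phi w) * a w)%R) ->
  nu.-integrable setT (fun z => (F z * k z)%:E) ->
  mu.-integrable setT (fun w => (F (phi w) * a w)%:E).
Proof.
move=> mF mFa /integrableP[_ iF]; apply/integrableP; split.
  exact/measurable_EFinP.
rewrite (eq_integral (fun w => (`|F (phi w)|%R)%:E * (a w)%:E)); last first.
  by move=> w _; rewrite /= normrM (ger0_norm (a0 _)) EFinM.
rewrite (ge0_transfer (fun z => (`|F z|%R)%:E))//.
  rewrite (eq_integral (fun z => `|(F z * k z)%:E|))//.
  by move=> z _; rewrite /= normrM (ger0_norm (k0 _)) EFinM.
by apply/measurable_EFinP; exact: measurableT_comp.
Qed.

End Transfer.

(* [measurableTypeR R] and [R] have the same measurable sets but different
   displays; [lebesgue_measure] and [normal_prob] live on the former, and so do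
   the random variables below. *)
Section NormalLaws.
Context {d} {T : measurableType d} {R : realType} (P : probability T R).
Local Open Scope ereal_scope.
Local Notation leb := (@lebesgue_measure R).

(** Parameterized by the standard deviation, in contrast with [normal_law], so that independent sums
    add squares. *)
Definition has_normal_law (X : T -> R) (m s : R) :=
  forall A : set R, measurable A -> P (X @^-1` A) = normal_prob m s A.

Lemma ge0_integral_normal_law (X : {RV P >-> measurableTypeR R}) (m s : R) (G : R -> \bar R) :
  has_normal_law X m s -> measurable_fun setT G -> (forall x, 0 <= G x) ->
  \int[distribution P X]_x G x = \int[leb]_x (G x * (normal_pdf m s x)%:E).
Proof.
move=> law mG G0; rewrite -ge0_integral_normal_prob//.
by apply: eq_measure_integral => A mA _; exact: law.
Qed.

(** For fixed [x] the shear is a translation by [c x], with unit Jacobian, performed inside the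
    inner integral. *)
Lemma ge0_integral_sheared_normal (X Y : {RV P >-> measurableTypeR R}) (m1 m2 s1 s2 c : R)
    (G : R * R -> \bar R) :
  independent_pair P X Y -> has_normal_law X m1 s1 -> has_normal_law Y m2 s2 ->
  measurable_fun setT G -> (forall z, 0 <= G z) ->
  \int[P]_w G (X w, c * X w + Y w)%R =
  \int[leb \x leb]_z (G z *
    (normal_pdf m1 s1 z.1 * normal_pdf m2 s2 (z.2 - c * z.1))%:E).
Proof.
move=> XY lX lY mG G0.
have mshear (e : R) : measurable_fun setT (fun z : R * R => (z.1, e * z.1 + z.2)%R).
  apply: measurable_fun_pair => //; apply: measurable_funD => //.
  exact: measurable_funM.
have mpdf (m s : R) := @measurable_normal_pdf R m s.
pose F (z : R * R) := G (z.1, c * z.1 + z.2)%R.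
have mF : measurable_fun setT F by exact: (measurableT_comp mG (mshear c)).
rewrite -[LHS]/(\int[P]_w F (X w, Y w)) (ge0_integral_independent P X Y F XY)//.
rewrite fubini_tonelli1//; last 2 first.
- apply: emeasurable_funM => //; apply/measurable_EFinP/measurable_funM.
    exact: (measurableT_comp (mpdf m1 s1) measurable_fst).
  apply: (measurableT_comp (mpdf m2 s2)); apply: measurable_funB => //.
  exact: measurable_funM.
- by move=> z; rewrite mule_ge0// lee_fin mulr_ge0 ?normal_pdf_ge0.
have F0 z : 0 <= F z by exact: G0.
have mF2 (x : R) : measurable_fun setT (fun y : R => F (x, y)).
  exact: (measurableT_comp mF (measurable_pair1 x)).
rewrite (ge0_integral_normal_law X m1 s1)//; last 2 first.
- exact: measurable_fun_fubini_tonelli_F.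
- by move=> x; apply: integral_ge0 => y _; exact: F0.
apply: eq_integral => x _; rewrite (ge0_integral_normal_law Y m2 s2)//.
rewrite muleC -ge0_integralZl_EFin ?normal_pdf_ge0//; last 2 first.
- by move=> y _; rewrite mule_ge0// ?lee_fin ?normal_pdf_ge0//; exact: F0.
- apply: emeasurable_funM; [exact: mF2|apply/measurable_EFinP]. exact: mpdf.
rewrite (integral_affine 1 (- (c * x))) ?oner_neq0//; last first.
  apply: emeasurable_funM; first exact: measurable_cst.
  by apply: emeasurable_funM; [exact: mF2|apply/measurable_EFinP; exact: mpdf].
rewrite normr1 mul1e; apply: eq_integral => y _.
rewrite /F/= mul1r (_ : c * x + (y - c * x) = y)%R; last by rewrite addrC subrK.
by rewrite EFinM muleCA.
all: by move=> z; exact: G0.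
Qed.


End NormalLaws.

Section NormalRV.
Context {d} {T : measurableType d} {R : realType} (P : probability T R).
Local Notation leb := (@lebesgue_measure R).

Lemma has_normal_law_affine (X : T -> R) (m s a b : R) : a != 0 -> s != 0 ->
  has_normal_law P X m s ->
  has_normal_law P (fun w => a * X w + b) (a * m + b) (`|a| * s).
Proof.
move=> a0 s0 law A mA.
pose B : set R := (fun x => a * x + b) @^-1` A.
have mB : measurable B.
  by rewrite -[B]setTI; exact: (measurable_affine a b).
rewrite -[LHS]/(P (X @^-1` B)) law// /normal_prob [RHS]integral_mkcond.
rewrite (integral_affine a b)//; last first.
  apply/(measurable_restrictT _ _).1 => //.
  by apply/measurable_funTS/measurable_EFinP; exact: measurable_normal_pdf.
rewrite -ge0_integralZl_EFin//; last 2 first.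
- move=> x _; rewrite patchE; case: ifP => // _; rewrite lee_fin normal_pdf_ge0 //.
- apply: (@measurableT_comp _ _ _ _ _ _ ((EFin \o normal_pdf (a * m + b) (`|a| * s)) \_ A)).
    apply/(measurable_restrictT _ _).1 => //.
    by apply/measurable_funTS/measurable_EFinP; exact: measurable_normal_pdf.
  exact: measurable_affine.
rewrite [LHS]integral_mkcond; apply: eq_integral => x _.
rewrite !patchE/= normal_pdf_affine//.
rewrite (_ : (x \in B) = (a * x + b \in A)); last first.
  by apply/idP/idP => /set_mem xA; exact: mem_set.
case: ifP => _; last by rewrite mule0.
by rewrite -EFinM mulrA divff ?mul1r// normr_eq0.
Qed.

Lemma measurable_real_RV (X : {RV P >-> measurableTypeR R}) :
  measurable_fun [set: T] (X : T -> R).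
Proof. exact: (@measurable_funPT _ _ T (measurableTypeR R) X). Qed.

(** In the factored density of [(X, c X + Y)] the conditional density integrates to 1 in [x],
    leaving the normal marginal. *)
Lemma has_normal_law_lincomb (X Y : {RV P >-> measurableTypeR R})
    (m1 m2 s1 s2 c S : R) :
  s1 != 0 -> s2 != 0 -> S != 0 -> S ^+ 2 = c ^+ 2 * s1 ^+ 2 + s2 ^+ 2 ->
  independent_pair P X Y -> has_normal_law P X m1 s1 -> has_normal_law P Y m2 s2 ->
  has_normal_law P (fun w => c * X w + Y w) (c * m1 + m2) S.
Proof.
move=> s10 s20 S0 SE XY lX lY A mA.
have mZ : measurable_fun setT (fun w => c * X w + Y w).
  apply: measurable_funD; last exact: measurable_real_RV.
  by apply: measurable_funM => //; exact: measurable_real_RV.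
pose G (z : R * R) : \bar R := (\1_A z.2)%:E.
have indE w : (\1_((fun w => c * X w + Y w) @^-1` A) w)%:E = G (X w, c * X w + Y w) by [].
transitivity (\int[P]_w G (X w, c * X w + Y w)%R)%E.
  rewrite -(eq_integral _ _ (fun w _ => indE w)) integral_indic ?setIT//.
  by rewrite -[X in measurable X]setTI; exact: mZ.
have mG : measurable_fun setT G.
  apply/measurable_EFinP; apply: (measurableT_comp _ measurable_snd).
  exact: measurable_indic.
have G0 z : (0 <= G z)%E by rewrite lee_fin.
rewrite (ge0_integral_sheared_normal P X Y m1 m2 s1 s2 c)//.
(* Conditional mean and standard deviation of [X] given [c X + Y = g]. *)
pose pm g := m1 + c * s1 ^+ 2 / S ^+ 2 * (g - (c * m1 + m2)); pose ps := s1 * s2 / S.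
rewrite fubini_tonelli2//; last 2 first.
- apply: emeasurable_funM => //; apply/measurable_EFinP/measurable_funM.
    exact: (measurableT_comp (measurable_normal_pdf m1 s1) measurable_fst).
  apply: (measurableT_comp (measurable_normal_pdf m2 s2)); apply: measurable_funB => //.
  exact: measurable_funM.
- by move=> z; rewrite mule_ge0// lee_fin mulr_ge0 ?normal_pdf_ge0.
rewrite /normal_prob [RHS]integral_mkcond; apply: eq_integral => g _.
transitivity (\int[leb]_x ((\1_A g * normal_pdf (c * m1 + m2) S g)%:E *
    (normal_pdf (pm g) ps x)%:E))%E.
  apply: eq_integral => x _; rewrite -!EFinM -mulrA; congr (_ * _)%:E.
  exact: normal_pdf_product.
rewrite ge0_integralZl_EFin//; last 3 first.
- by move=> x _; rewrite lee_fin normal_pdf_ge0.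
- by apply/measurable_EFinP; exact: (@measurable_normal_pdf R (pm g) ps).
- by rewrite mulr_ge0// normal_pdf_ge0.
rewrite integral_normal_pdf mule1 patchE indicE.
by case: ifP => _; rewrite ?mul1r ?mul0r.
Qed.

Lemma ge0_expect_normal (X : {RV P >-> measurableTypeR R}) (m s : R) (G : R -> \bar R) :
  has_normal_law P X m s -> measurable_fun setT G -> (forall x, 0 <= G x)%E ->
  (\int[P]_w G (X w) = \int[leb]_x (G x * (normal_pdf m s x)%:E))%E.
Proof.
move=> lX mG G0; rewrite -(ge0_integral_normal_law P X)//.
by rewrite ge0_integral_distribution.
Qed.

Lemma normal_law_transfer (X : {RV P >-> measurableTypeR R}) (m s : R) (F : R -> R) :
  has_normal_law P X m s -> measurable_fun [set: R] F ->
  (\int[P]_w (F (X w))%:E = \int[leb]_x (F x * normal_pdf m s x)%:E)%E /\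
  (leb.-integrable [set: R] (fun x : R => (F x * normal_pdf m s x)%:E) ->
   P.-integrable [set: T] (fun w => (F (X w))%:E)).
Proof.
move=> lX mF.
have tr (G : R -> \bar R) : measurable_fun setT G -> (forall x, 0 <= G x)%E ->
  (\int[P]_w (G (X w) * 1%:E) = \int[leb]_x (G x * (normal_pdf m s x)%:E))%E.
  move=> mG G0; rewrite -(ge0_expect_normal X)//.
  by apply: eq_integral => w _; rewrite mule1.
have k0 x := normal_pdf_ge0 m s x.
have a0 (w : T) : 0 <= (1 : R) by [].
have eq1 : (fun w => (F (X w))%:E) = (fun w => (F (X w) * 1)%:E).
  by apply/funext => w; rewrite mulr1.
rewrite eq1; split.
  exact: (integral_transfer _ _ _ _ _ P leb X (fun=> 1) (normal_pdf m s)
    a0 k0 tr F).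
move=> iF.
refine (integrable_transfer _ _ _ _ _ P leb X (fun=> 1) (normal_pdf m s)
  a0 k0 tr F mF _ iF).
under eq_fun do rewrite mulr1.
exact: (measurableT_comp mF (measurable_real_RV X)).
Qed.

Lemma normal_law_mean (X : {RV P >-> measurableTypeR R}) (m s : R) : s != 0 ->
  has_normal_law P X m s -> P.-integrable setT (fun w => (X w)%:E) /\
  (\int[P]_w (X w)%:E = m%:E)%E.
Proof.
move=> s0 lX; have mid : measurable_fun [set: R] (fun x : R => x) by exact: measurable_id.
have [ipdf <-] := integral_normal_mean m s s0.
by have [e i] := normal_law_transfer X m s (fun x => x) lX mid; split; [exact: i|exact: e].
Qed.

(** Square integrability feeds [varianceD] and the finiteness of the covariance. *)
Lemma normal_law_Lfun2 (X : {RV P >-> measurableTypeR R}) (m s : R) : s != 0 ->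
  has_normal_law P X m s -> (X : T -> R) \in Lfun P 2%:E.
Proof.
move=> s0 lX; have mX := measurable_real_RV X.
have mXm : measurable_fun setT (fun w => X w - m) by exact: measurable_funB.
have cX : (fun w => X w - m) \in Lfun P 2%:E.
  rewrite inE; apply/andP; split; rewrite inE//=.
  rewrite /finite_norm unlock poweR_lty//.
  pose G (x : R) : \bar R := ((x - m) ^+ 2)%:E.
  have mG : measurable_fun setT G.
    by apply/measurable_EFinP; apply: measurable_funX; exact: measurable_funB.
  have G0 x : (0 <= G x)%E by rewrite lee_fin sqr_ge0.
  rewrite (eq_integral (fun w => G (X w))); last first.
    by move=> w _; rewrite /= powR_mulrn// real_normK ?num_real.
  by rewrite (ge0_expect_normal X m s)// integral_normal_variance// ltry.
have -> : (X : T -> R) = (fun w => X w - m) + cst m.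
  by apply/funext => w /=; rewrite !fctE/= subrK.
have h12 : (1 <= 2%:E :> \bar R)%E by rewrite lee_fin ler1n.
have [_] := @Lfun_addr_closed _ _ _ P _ h12; apply; [exact: cX|exact: Lfun_cst].
Qed.

Lemma normal_law_expectation (X : {RV P >-> measurableTypeR R}) (m s : R) :
  s != 0 -> has_normal_law P X m s -> ('E_P[X] = m%:E)%E.
Proof.
by move=> s0 lX; rewrite unlock; have [] := normal_law_mean X m s s0 lX.
Qed.

Lemma normal_law_variance (X : {RV P >-> measurableTypeR R}) (m s : R) :
  s != 0 -> has_normal_law P X m s -> ('V_P[X] = (s ^+ 2)%:E)%E.
Proof.
move=> s0 lX; rewrite /variance unlock (normal_law_expectation X m s)//=.
rewrite unlock/= -(integral_normal_variance m s)//.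
pose G (x : R) : \bar R := ((x - m) ^+ 2)%:E.
have mG : measurable_fun setT G.
  by apply/measurable_EFinP; apply: measurable_funX; exact: measurable_funB.
have G0 x : (0 <= G x)%E by rewrite lee_fin sqr_ge0.
transitivity (\int[P]_w G (X w))%E; last first.
  by rewrite (ge0_expect_normal X m s).
by apply: eq_integral => w _; rewrite /G expr2.
Qed.

End NormalRV.

(** * Truncated normal means *)

(* Here [u g] is the conditional mean of [x] given [g] under the density [j], and
   [uE] states it without dividing by the marginal density of [g]. *)
Section ConditionalMean.
Context {R : realType}.
Local Open Scope ereal_scope.
Local Notation leb := (@lebesgue_measure R).
Variables (j : R * R -> R) (u : R -> R).
Hypotheses (mj : measurable_fun setT j) (mu : measurable_fun setT u).
Hypothesis j0 : forall z, (0 <= j z)%R.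
Hypothesis ij : forall g : R, leb.-integrable setT (fun x : R => (j (x, g))%:E).
Hypothesis ixj : (leb \x leb).-integrable setT (fun z : R * R => (z.1 * j z)%:E).
Hypothesis uE : forall g : R,
  (u g)%:E * \int[leb]_x (j (x, g))%:E = \int[leb]_x (x * j (x, g))%:E.

(** Conditional expectation contracts the L1 norm: for each [g], [|u g|] times the marginal equals
    the absolute value of the integral of [x * j], at most the integral of [|x| * j]. *)
Lemma integrable_conditional_mean :
  (leb \x leb).-integrable setT (fun z : R * R => (u z.2 * j z)%:E).
Proof.
have muj : measurable_fun setT (fun z : R * R => (u z.2 * j z)%:E).
  apply/measurable_EFinP/measurable_funM => //.
  exact: (measurableT_comp mu measurable_snd).
apply: (@integrable21ltyP _ _ _ _ R leb leb _ muj).2.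
have mxj : measurable_fun setT (fun z : R * R => (z.1 * j z)%:E).
  exact: (measurable_int _ ixj).
have := (@integrable21ltyP _ _ _ _ R leb leb _ mxj).1 ixj.
have mG (f : R * R -> \bar R) : measurable_fun setT f ->
    measurable_fun setT (fun g : R => \int[leb]_x `|f (x, g)|).
  move=> mf; apply: (@measurable_fun_fubini_tonelli_G _ _ _ _ R leb (fun z => `|f z|)) => //.
  exact: measurableT_comp.
apply: le_lt_trans; apply: ge0_le_integral => //.
- by move=> g _; apply: integral_ge0.
- exact: (mG _ muj).
- exact: (mG _ mxj).
move=> g _ /=.
have mxjg : measurable_fun setT (fun x : R => (x * j (x, g))%:E).
  exact: (measurableT_comp mxj (measurable_pair2 g)).
apply: le_trans (le_abse_integral leb measurableT mxjg).
rewrite -uE abseM (@gee0_abs _ (\int[leb]_x _)); last first.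
  by apply: integral_ge0 => x _; rewrite lee_fin.
rewrite -ge0_integralZl//; last 2 first.
- exact: (measurable_int _ (ij g)).
- by move=> x _; rewrite lee_fin.
rewrite le_eqVlt; apply/orP; left; apply/eqP/eq_integral => x _.
by rewrite -EFinM /= normrM (ger0_norm (j0 _)).
Qed.

(** At each [g], [uE] cancels the two inner integrals. The abstract [j] covers both the truncated
    regression, with [u] affine, and the Bayes posterior mean. *)
Lemma integral_conditional_mean_error :
  (leb \x leb).-integrable setT (fun z : R * R => ((z.1 - u z.2) * j z)%:E) /\
  \int[leb \x leb]_z ((z.1 - u z.2) * j z)%:E = 0.
Proof.
have iuj := integrable_conditional_mean.
have sE : (fun z : R * R => ((z.1 - u z.2) * j z)%:E) =
  (fun z : R * R => (z.1 * j z)%:E) \- (fun z : R * R => (u z.2 * j z)%:E).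
  by apply/funext => z /=; rewrite mulrBl EFinB.
rewrite sE; split; first exact: integrableB.
rewrite integralB//.
rewrite -(integral21_prod_meas1 ixj) -(integral21_prod_meas1 iuj).
rewrite [X in _ - X](_ : _ = \int[leb]_g fubini_G leb (fun z : R * R => (z.1 * j z)%:E) g).
  rewrite subee// (integral21_prod_meas1 ixj).
  exact: (integrable_fin_num measurableT ixj).
apply: eq_integral => g _; rewrite /fubini_G.
transitivity (\int[leb]_x ((u g)%:E * (j (x, g))%:E)).
  by apply: eq_integral => x _; rewrite EFinM.
by rewrite (integralZl measurableT (ij g)) uE.
Qed.

End ConditionalMean.

Section NormalSelection.
Context {d} {T : measurableType d} {R : realType} (P : probability T R).
Local Notation leb := (@lebesgue_measure R).

Definition real_RV (f : T -> R) (mf : measurable_fun [set: T] f) :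
  {RV P >-> measurableTypeR R} :=
  HB.pack f (isMeasurableFun.Build _ _ T (measurableTypeR R) f mf).

(** With [Z = c X + Y], split [X - m1 = (X - pm Z) + b (Z - E Z)]. The event depends on [Z] alone,
    so the regression residual integrates to zero over it. The case [c = 0] is included and serves
    the outcome noise. *)
Lemma truncated_normal_lincomb (X Y : {RV P >-> measurableTypeR R})
    (m1 m2 s1 s2 c S h : R) :
  s1 != 0 -> s2 != 0 -> S != 0 -> S ^+ 2 = c ^+ 2 * s1 ^+ 2 + s2 ^+ 2 ->
  independent_pair P X Y -> has_normal_law P X m1 s1 -> has_normal_law P Y m2 s2 ->
  (\int[P]_(w in [set w | (c * X w + Y w <= h)%R]) (X w - m1)%:E =
   (- (c * s1 ^+ 2) * normal_pdf (c * m1 + m2) S h)%:E)%E.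
Proof.
move=> s10 s20 S0 SE XY lX lY.
pose pm g := m1 + c * s1 ^+ 2 / S ^+ 2 * (g - (c * m1 + m2)).
pose ps := s1 * s2 / S.
have ps0 : ps != 0 by rewrite !mulf_neq0 ?invr_neq0.
pose jj (z : R * R) := normal_pdf m1 s1 z.1 * normal_pdf m2 s2 (z.2 - c * z.1).
have jjE x g : jj (x, g) = normal_pdf (c * m1 + m2) S g * normal_pdf (pm g) ps x.
  exact: normal_pdf_product.
have mX := measurable_real_RV P X; have mY := measurable_real_RV P Y.
have mZ : measurable_fun setT (fun w => c * X w + Y w).
  by apply: measurable_funD => //; exact: measurable_funM.
pose Z := real_RV _ mZ.
have lZ : has_normal_law P Z (c * m1 + m2) S.
  exact: (has_normal_law_lincomb P X Y m1 m2 s1 s2 c S).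
have mjj : measurable_fun [set: R * R] jj.
  apply: measurable_funM.
    exact: (measurableT_comp (measurable_normal_pdf m1 s1) measurable_fst).
  apply: (measurableT_comp (measurable_normal_pdf m2 s2)); apply: measurable_funB => //.
  exact: measurable_funM.
have jj0 z : 0 <= jj z by rewrite mulr_ge0 ?normal_pdf_ge0.
have tr (G : R * R -> \bar R) : measurable_fun setT G -> (forall z, 0 <= G z)%E ->
    (\int[P]_w (G (X w, Z w) * 1%:E) = \int[(leb \x leb)%E]_z (G z * (jj z)%:E))%E.
  move=> mG G0; rewrite -(ge0_integral_sheared_normal P X Y m1 m2 s1 s2 c)//.
  by apply: eq_integral => w _; rewrite mule1.
pose ind : R -> R := \1_(`]-oo, h]%classic).
have mind : measurable_fun [set: R] ind by exact: measurable_indic.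
have ind0 g : 0 <= ind g by [].
have ind1 g : `|ind g| <= 1 by rewrite ger0_norm// /ind indicE; case: (_ \in _).
(* A cut in the second coordinate leaves the conditional mean [pm] unchanged, so [uE] survives the
   truncation. *)
pose j (z : R * R) := jj z * ind z.2.
have mj : measurable_fun [set: R * R] j.
  by apply: measurable_funM => //; exact: (measurableT_comp mind measurable_snd).
have j0 z : 0 <= j z by rewrite mulr_ge0.
have jE x g : j (x, g) = normal_pdf (c * m1 + m2) S g * ind g * normal_pdf (pm g) ps x.
  by rewrite /j jjE/= mulrAC.
have ij g : leb.-integrable [set: R] (fun x : R => (j (x, g))%:E).
  under eq_fun do rewrite jE EFinM.
  by apply: integrableZl => //; exact: integrable_normal_pdf.
have mpm : measurable_fun [set: R] pm.
  apply: measurable_funD => //; apply: measurable_funM => //.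
  exact: measurable_funB.
have [iX _] := normal_law_mean P X m1 s1 s10 lX.
(* Finiteness on the plane is read off from that of [E|X|], through the identity [tr]. *)
have ixjj : (leb \x leb)%E.-integrable [set: R * R] (fun z : R * R => (z.1 * jj z)%:E).
  apply/integrableP; split; first exact/measurable_EFinP/measurable_funM.
  have /integrableP[_] := iX; apply: le_lt_trans.
  rewrite le_eqVlt; apply/orP; left; apply/eqP.
  pose A (z : R * R) : \bar R := (`|z.1|)%:E.
  transitivity (\int[P]_w (A (X w, Z w) * 1%:E))%E; last first.
    by apply: eq_integral => w _; rewrite mule1.
  have A0 z : (0 <= A z)%E by rewrite lee_fin.
  have mA : measurable_fun [set: R * R] A.
    apply: (measurableT_comp (@EFin_measurable R setT)).
    exact: (measurableT_comp (@normr_measurable R setT) measurable_fst).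
  rewrite (tr A mA A0).
  by apply: eq_integral => z _; rewrite /= normrM (ger0_norm (jj0 _)) EFinM.
have ixj : (leb \x leb)%E.-integrable [set: R * R] (fun z : R * R => (z.1 * j z)%:E).
  apply: le_integrable ixjj => //.
    by apply/measurable_EFinP/measurable_funM.
  move=> z _; rewrite /= lee_fin mulrA normrM ler_piMr//.
have uE g : ((pm g)%:E * \int[leb]_x (j (x, g))%:E = \int[leb]_x (x * j (x, g))%:E)%E.
  have [ipm epm] := integral_normal_mean (pm g) ps ps0.
  pose k := normal_pdf (c * m1 + m2) S g * ind g.
  transitivity ((pm g)%:E * (k%:E * \int[leb]_x (normal_pdf (pm g) ps x)%:E))%E.
    congr (_ * _)%E; rewrite -integralZl//; last exact: integrable_normal_pdf.
    by apply: eq_integral => x _; rewrite jE EFinM.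
  rewrite integral_normal_pdf mule1 muleC -epm -integralZl//.
  by apply: eq_integral => x _; rewrite -EFinM jE mulrCA.
have [ierr err0] := integral_conditional_mean_error j pm mj mpm j0 ij ixj uE.
pose F (z : R * R) := (z.1 - pm z.2) * ind z.2.
have mF : measurable_fun [set: R * R] F.
  apply: measurable_funM; last exact: (measurableT_comp mind measurable_snd).
  by apply: measurable_funB => //; exact: (measurableT_comp mpm measurable_snd).
have FjE : (fun z => (F z * jj z)%:E) = (fun z => ((z.1 - pm z.2) * j z)%:E).
  by apply/funext => z; rewrite /F /j -mulrA (mulrC (ind _)).
have a0 (w : T) : 0 <= (1 : R) by [].
have e1 : (\int[P]_w (F (X w, Z w) * 1)%:E = 0)%E.
  rewrite (integral_transfer _ _ _ _ _ P (leb \x leb)%E (fun w => (X w, Z w))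
    (fun=> 1) jj a0 jj0 tr F mF).
  by rewrite FjE.
have i1 : P.-integrable [set: T] (fun w => (F (X w, Z w) * 1)%:E).
  apply: (integrable_transfer _ _ _ _ _ P (leb \x leb)%E (fun w => (X w, Z w))
    (fun=> 1) jj a0 jj0 tr F mF).
    apply: measurable_funM => //; apply: (measurableT_comp mF).
    by apply: measurable_fun_pair => //; exact: mZ.
  by rewrite FjE.
pose H g := (g - (c * m1 + m2)) * ind g.
have mH : measurable_fun [set: R] H by apply: measurable_funM => //; exact: measurable_funB.
have [e2 i2] := normal_law_transfer P Z (c * m1 + m2) S H lZ mH.
have HE : (\int[leb]_x (H x * normal_pdf (c * m1 + m2) S x)%:E =
    (- S ^+ 2 * normal_pdf (c * m1 + m2) S h)%:E)%E.
  rewrite -integral_normal_truncated_mean// [RHS]integral_mkcond.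
  apply: eq_integral => x _; rewrite patchE /H /ind indicE.
  by case: (x \in _); rewrite ?mulr1// mulr0 mul0r.
have {}i2 : P.-integrable [set: T] (fun w => (H (Z w))%:E).
  apply: i2; have [ipm _] := integral_normal_mean (c * m1 + m2) S S0.
  have ic : leb.-integrable [set: R] (fun x : R =>
      ((c * m1 + m2)%:E * (normal_pdf (c * m1 + m2) S x)%:E)%E).
    by apply: integrableZl => //; exact: integrable_normal_pdf.
  have ib := @integrableB _ _ _ leb _ measurableT _ _ ipm ic.
  apply: le_integrable ib => //.
    by apply/measurable_EFinP/measurable_funM => //; exact: measurable_normal_pdf.
  move=> x _; rewrite /= lee_fin /H mulrAC normrM -mulrBl.
  by rewrite ler_piMr.
(* Regression slope of [X] on [Z]; its denominator cancels the [S ^+ 2] of the truncated mean of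
   [Z]. *)
pose b := c * s1 ^+ 2 / S ^+ 2.
rewrite integral_mkcond.
transitivity (\int[P]_w ((F (X w, Z w) * 1)%:E + b%:E * (H (Z w))%:E))%E.
  apply: eq_integral => w _; rewrite patchE -EFinM -EFinD mulr1.
  have -> : F (X w, Z w) + b * H (Z w) = (X w - m1) * ind (Z w).
    by rewrite /F /H /pm /b /=; ring.
  have -> : ind (Z w) = (c * X w + Y w <= h)%R%:R.
    by rewrite /ind indicE mem_setE in_itv.
  have [zh|zh] := leP (c * X w + Y w) h.
    by rewrite mem_set//= mulr1.
  by rewrite memNset/= ?mulr0//; apply/negP; rewrite -ltNge.
rewrite integralD//; last exact: integrableZl.
rewrite e1 add0e integralZl// e2 HE -EFinM; congr EFin.
by rewrite /b; field.
Qed.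
End NormalSelection.

(** * Posterior means *)

Section Bayes.
Context {R : realType}.
Local Notation leb := (@lebesgue_measure R).

Lemma integral_gt0 (f : R -> R) : measurable_fun [set: R] f ->
  (forall x, 0 < f x) -> (0 < \int[leb]_x (f x)%:E)%E.
Proof.
move=> mf f0; apply: lt_le_trans (integral_gt0_itvNyo 0 f mf (fun x _ => f0 x)) _.
apply: ge0_subset_integral => //; first exact/measurable_EFinP.
by move=> x _; rewrite lee_fin ltW.
Qed.

Lemma bayes_mean_ratio (joint : R -> R -> R) (z : R) :
  leb.-integrable [set: R] (fun t : R => (t * joint t z)%:E) ->
  bayes_mean joint z =
  (\int[leb]_t (joint t z))^-1 * \int[leb]_t (t * joint t z).
Proof.
move=> itj; rewrite /bayes_mean -RintegralZl//; apply: eq_Rintegral => t _.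
by rewrite /bayes_pdf mulrA mulrC.
Qed.

(** The form required by [integral_conditional_mean_error]. Positivity of [joint] keeps the
    normalizing integral away from zero, where the inverse is a default value. *)
Lemma bayes_meanE (joint : R -> R -> R) (z : R) : (forall t, 0 < joint t z) ->
  leb.-integrable [set: R] (fun t : R => (joint t z)%:E) ->
  leb.-integrable [set: R] (fun t : R => (t * joint t z)%:E) ->
  ((bayes_mean joint z)%:E * \int[leb]_t (joint t z)%:E =
   \int[leb]_t (t * joint t z)%:E)%E.
Proof.
move=> j0 ij itj; rewrite bayes_mean_ratio//; set D := \int[leb]_t (joint t z).
have DE : (\int[leb]_t (joint t z)%:E = D%:E)%E.
  by rewrite /D /Rintegral fineK//; exact: (integrable_fin_num measurableT ij).
have D0 : D != 0.
  rewrite gt_eqF// -lte_fin -DE; apply: integral_gt0 => //.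
  by apply/measurable_EFinP; exact: (measurable_int _ ij).
rewrite DE -EFinM mulrAC mulVf// mul1r /Rintegral fineK//.
exact: (integrable_fin_num measurableT itj).
Qed.

(** The case [c = 1] of [normal_pdf_product], [z] being [t] plus an independent error; the
    regression formulas become precision-weighted. *)
Lemma normal_pdf_conjugate (m q r z t : R) : 0 < q -> 0 < r ->
  normal_pdf m (Num.sqrt q^-1) t * normal_pdf t (Num.sqrt r^-1) z =
  normal_pdf m (Num.sqrt (q^-1 + r^-1)) z *
  normal_pdf ((q * m + r * z) / (q + r)) (Num.sqrt (q + r)^-1) t.
Proof.
move=> q0 r0; have qr0 : 0 < q + r by rewrite addr_gt0.
have qi0 : 0 <= q^-1 by rewrite invr_ge0 ltW.
have ri0 : 0 <= r^-1 by rewrite invr_ge0 ltW.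
have s0 : 0 < q^-1 + r^-1 by rewrite addr_gt0 ?invr_gt0.
set a := Num.sqrt q^-1; set b := Num.sqrt r^-1; set S := Num.sqrt (q^-1 + r^-1).
have aE : a ^+ 2 = q^-1 by rewrite sqr_sqrtr.
have bE : b ^+ 2 = r^-1 by rewrite sqr_sqrtr.
have SE : S ^+ 2 = q^-1 + r^-1 by rewrite sqr_sqrtr ?ltW.
have a0 : a != 0 by rewrite gt_eqF// sqrtr_gt0 invr_gt0.
have b0 : b != 0 by rewrite gt_eqF// sqrtr_gt0 invr_gt0.
have S0 : S != 0 by rewrite gt_eqF// sqrtr_gt0.
have -> : normal_pdf t b z = normal_pdf 0 b (z - 1 * t).
  by rewrite mul1r -(normal_pdf_center t b _ b0) subrK.
have SE' : S ^+ 2 = 1 ^+ 2 * a ^+ 2 + b ^+ 2 by rewrite aE bE SE expr1n mul1r.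
rewrite (normal_pdf_product m 0 a b 1 S t z a0 b0 S0 SE').
have -> : 1 * m + 0 = m by rewrite mul1r addr0.
have -> : m + 1 * a ^+ 2 / S ^+ 2 * (z - m) = (q * m + r * z) / (q + r).
  rewrite aE SE; field.
  by rewrite (gt_eqF q0) (gt_eqF r0) (gt_eqF qr0) ?(addrC r) ?(gt_eqF qr0).
have -> // : a * b / S = Num.sqrt (q + r)^-1.
rewrite -[LHS]ger0_norm; last by rewrite divr_ge0 ?mulr_ge0 ?sqrtr_ge0.
rewrite -sqrtr_sqr; congr Num.sqrt; rewrite exprMn exprVn exprMn aE bE SE; field.
by rewrite (gt_eqF q0) (gt_eqF r0) (gt_eqF qr0) ?(addrC r) ?(gt_eqF qr0).
Qed.

Lemma unselected_jointE (p : params R) (z t : R) :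
  unselected_joint p t z =
  normal_pdf (prior_mean p) (Num.sqrt ((prior_prec p)^-1 + (precz p)^-1)) z *
  normal_pdf ((prior_prec p * prior_mean p + precz p * z) / (prior_prec p + precz p))
             (Num.sqrt (prior_prec p + precz p)^-1) t.
Proof. exact: (normal_pdf_conjugate _ _ _ _ _ (prior_prec_gt0 p) (precz_gt0 p)). Qed.

Lemma bayes_pdf_unselected (p : params R) (z t : R) :
  bayes_pdf (unselected_joint p) z t =
  normal_pdf ((prior_prec p * prior_mean p + precz p * z) / (prior_prec p + precz p))
             (Num.sqrt (prior_prec p + precz p)^-1) t.
Proof.
have t0 := prior_prec_gt0 p; have z0 := precz_gt0 p.
have S0 : Num.sqrt ((prior_prec p)^-1 + (precz p)^-1) != 0.
  by rewrite gt_eqF// sqrtr_gt0 addr_gt0 ?invr_gt0.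
rewrite /bayes_pdf.
under eq_Rintegral do rewrite unselected_jointE.
rewrite RintegralZl//; last exact: integrable_normal_pdf.
rewrite [X in _ / (_ * X)]/Rintegral integral_normal_pdf mulr1 unselected_jointE.
by rewrite mulrAC divff ?mul1r// gt_eqF// normal_pdf_gt0.
Qed.

Lemma bayes_mean_unselected (p : params R) (z : R) :
  bayes_mean (unselected_joint p) z =
  (prior_prec p * prior_mean p + precz p * z) / (prior_prec p + precz p).
Proof.
have s0 : Num.sqrt (prior_prec p + precz p)^-1 != 0.
  by rewrite gt_eqF// sqrtr_gt0 invr_gt0 addr_gt0 ?prior_prec_gt0 ?precz_gt0.
rewrite /bayes_mean; under eq_Rintegral do rewrite bayes_pdf_unselected.
by rewrite /Rintegral (integral_normal_mean _ _ s0).2.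
Qed.

End Bayes.

(** * The Gaussian model *)

Section Model.
Context {d} {T : measurableType d} {R : realType} {P : probability T R}
  {p : params R} (M : gaussian_model P p).
Local Open Scope ring_scope.
Local Notation leb := (@lebesgue_measure R).

Let th := theta M. Let eS := epsS M. Let eB := epsB M. Let nn := nu M.

(** Slots filled with [setT] drop out, so this single identity yields the independence of the
    subfamilies. *)
Lemma shocks_joint (A0 A1 A2 A3 : set R) :
  measurable A0 -> measurable A1 -> measurable A2 -> measurable A3 ->
  P (th @^-1` A0 `&` eS @^-1` A1 `&` eB @^-1` A2 `&` nn @^-1` A3) =
  (P (th @^-1` A0) * P (eS @^-1` A1) * P (eB @^-1` A2) * P (nn @^-1` A3))%E.
Proof.
move=> mA0 mA1 mA2 mA3.
pose B (i : 'I_4) : set R := nth set0 [:: A0; A1; A2; A3] i.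
have mB i : measurable (B i) by rewrite /B; case: i => [[|[|[|[|i]]]]].
have := shocks_independent M finset.setT mB.
rewrite (eq_bigl predT); last by move=> i; rewrite finset.in_setT.
rewrite !big_ord_recr big_ord0 /=.
rewrite !(tnth_nth (th : T -> R))/= => e.
transitivity (P (\bigcap_(i in [set` [set: 'I_4]%SET])
  (tnth [tuple (th : T -> R); (eS : T -> R); (eB : T -> R); (nn : T -> R)] i
    @^-1` B i))); last first.
  by rewrite e; congr (_ * _ * _ * _)%E; exact: mul1e.
congr (P _).
apply/seteqP; split => [w [[[h0 h1] h2] h3] i _|w h].
  by rewrite (tnth_nth (th : T -> R)) /B; case: i {h0 h1 h2 h3} (h0, h1, h2, h3) =>
    [[|[|[|[|i]]]]] //= _ [[[]]].
have hh (i : 'I_4) := h i (finset.in_setT i).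
have := (hh ord0, hh (@Ordinal 4 1 isT), hh (@Ordinal 4 2 isT), hh (@Ordinal 4 3 isT)).
by rewrite !(tnth_nth (th : T -> R)) => -[[[]]].
Qed.

Let rth := real_RV P th (measurable_funPT th).
Let reS := real_RV P eS (measurable_funPT eS).
Let reB := real_RV P eB (measurable_funPT eB).
Let rnn := real_RV P nn (measurable_funPT nn).

Definition weight (q : R) : R := q / (prior_prec p + q).
(** Coefficient of [theta] in the gap; times the prior variance it is [Cov(theta, G)]. *)
Definition slope : R := weight (precS p) - weight (precB p).
Definition intercept : R :=
  prior_prec p * prior_mean p / (prior_prec p + precS p) -
  prior_prec p * prior_mean p / (prior_prec p + precB p).

Lemma measurable_noise : measurable_fun [set: T]
  (fun w => - weight (precB p) * eB w + (weight (precS p) * eS w + intercept)).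
Proof.
apply: measurable_funD; first exact: measurable_funM.
by apply: measurable_funD => //; exact: measurable_funM.
Qed.

(** The constant [intercept] is kept inside, so that the gap is exactly [slope * theta + noise]. *)
Definition noise : {RV P >-> measurableTypeR R} := real_RV P _ measurable_noise.

Lemma mean_gap_affine (t w1 w2 : R) : mean_gap p (t + w1) (t + w2) =
  slope * t + (- weight (precB p) * w2 + (weight (precS p) * w1 + intercept)).
Proof. by rewrite /mean_gap /agent_mean /slope /weight /intercept; ring. Qed.

Lemma gapE (w : T) : gap M w = slope * th w + noise w.
Proof. exact: mean_gap_affine. Qed.

(** Rectangles are extended to measurable sets one pair at a time, the event of the other pair being
    held fixed. *)
Lemma quality_outcome_noise_independent :
  independent_pair P (pair_RV P rth rnn) (pair_RV P reS reB).
Proof.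
have E1 : P [set: T] = 1%E by exact: probability_setT.
have preT (f : T -> R) : f @^-1` [set: R] = [set: T] by exact: preimage_setT.
have mp (X : {RV P >-> R}) (A : set R) : measurable A -> measurable (X @^-1` A).
  by move=> mA; rewrite -[X in measurable X]setTI; exact: measurable_funPT.
move=> S S' mS mS'.
pose E := pair_RV P rth rnn @^-1` S.
have mE : measurable E.
  by rewrite -[E]setTI; exact: (@measurable_funPT _ _ _ _ (pair_RV P rth rnn)).
rewrite -/E setIC [RHS]muleC.
apply: (pair_event_independent P reS reB E mE) => // A B mA mB.
rewrite setIC [RHS]muleC.
apply: (pair_event_independent P rth rnn) => //.
  by apply: measurableI; exact: mp.
move=> A0 A3 mA0 mA3.
have e1 := shocks_joint A0 A B A3 mA0 mA mB mA3.
have e2 := shocks_joint A0 setT setT A3 mA0 measurableT measurableT mA3.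
have e3 := shocks_joint setT A B setT measurableT mA mB measurableT.
rewrite !preT !setIT E1 !mule1 in e2.
rewrite !preT setIT setTI E1 mule1 mul1e in e3.
suff : P (th @^-1` A0 `&` nn @^-1` A3 `&` (eS @^-1` A `&` eB @^-1` B)) =
    (P (th @^-1` A0 `&` nn @^-1` A3) * P (eS @^-1` A `&` eB @^-1` B))%E by [].
rewrite e2 e3 muleACA (muleC (P (nn @^-1` A3))) muleA -e1; congr (P _).
by rewrite setIACA (setIC (nn @^-1` A3)) setIA.
Qed.

Lemma quality_outcome_independent : independent_pair P rth rnn.
Proof.
move=> A B mA mB; have := shocks_joint A setT setT B mA measurableT measurableT mB.
by rewrite !preimage_setT !setIT probability_setT !mule1.
Qed.

Lemma signal_errors_independent : independent_pair P reS reB.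
Proof.
move=> A B mA mB; have := shocks_joint setT A B setT measurableT mA mB measurableT.
by rewrite !preimage_setT setIT setTI probability_setT mule1 mul1e.
Qed.

Lemma pair_noise_independent : independent_pair P (pair_RV P rth rnn) noise.
Proof.
move=> S B mS mB.
pose f (z : R * R) := - weight (precB p) * z.2 + (weight (precS p) * z.1 + intercept).
have mf : measurable_fun [set: R * R] f.
  apply: measurable_funD; first exact: measurable_funM.
  by apply: measurable_funD => //; exact: measurable_funM.
apply: (quality_outcome_noise_independent S (f @^-1` B) mS).
by rewrite -[X in measurable X]setTI; exact: mf.
Qed.

Lemma quality_noise_independent : independent_pair P rth noise.
Proof.
move=> A B mA mB; have := pair_noise_independent (A `*` setT) B.
by rewrite (_ : _ @^-1` (A `*` setT) = th @^-1` A);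
  [apply => //; exact: measurableX|apply/seteqP; split => w //= []].
Qed.

Lemma measurable_gap : measurable_fun [set: T] (gap M).
Proof.
rewrite (_ : gap M = fun w => slope * th w + noise w); last exact/funext/gapE.
apply: measurable_funD; first exact: measurable_funM.
exact: (measurable_real_RV P noise).
Qed.

Definition gap_RV : {RV P >-> measurableTypeR R} := real_RV P _ measurable_gap.

(** The gap is a function of [(theta, noise)], so [nu] must be independent of that pair jointly, not
    of each member separately. *)
Lemma outcome_gap_independent : independent_pair P rnn gap_RV.
Proof.
move=> B C mB mC.
pose f (z : R * R) := slope * z.1 + z.2.
have mf : measurable_fun [set: R * R] f by apply: measurable_funD => //; exact: measurable_funM.
have mfC : measurable (f @^-1` C) by rewrite -[X in measurable X]setTI; exact: mf.
have mE : measurable (nn @^-1` B).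
  by rewrite -[X in measurable X]setTI; exact: (measurable_funPT nn).
have key := pair_event_independent P rth noise (nn @^-1` B) mE _ _ mfC.
have -> : gap_RV @^-1` C = pair_RV P rth noise @^-1` (f @^-1` C).
  by apply/seteqP; split => w; rewrite /preimage/= gapE.
rewrite setIC muleC; apply: key => A D mA mD.
have := pair_noise_independent (A `*` B) D (measurableX mA mB) mD.
rewrite (_ : _ @^-1` (A `*` B) = th @^-1` A `&` nn @^-1` B)// => e.
transitivity (P ((th @^-1` A `&` nn @^-1` B) `&` noise @^-1` D)).
  by congr (P _); rewrite setIAC.
rewrite e (quality_outcome_independent A B mA mB) (quality_noise_independent A D mA mD).
by rewrite muleAC.
Qed.

End Model.

(** * Law of the gap and its covariance with quality *)

Section GapLaw.
Context {d} {T : measurableType d} {R : realType} {P : probability T R}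
  {p : params R} (M : gaussian_model P p).
Local Notation leb := (@lebesgue_measure R).
Local Notation mu := (prior_mean p).

Let th := theta M. Let nn := nu M.
Let rth := real_RV P th (measurable_funPT th).
Let reS := real_RV P (epsS M) (measurable_funPT (epsS M)).
Let reB := real_RV P (epsB M) (measurable_funPT (epsB M)).
Let rnn := real_RV P nn (measurable_funPT nn).
Let wS := weight (p := p) (precS p). Let wB := weight (p := p) (precB p).

Definition prec_sd (q : R) := Num.sqrt q^-1.

Lemma prec_sd_neq0 (q : R) : 0 < q -> prec_sd q != 0.
Proof. by move=> q0; rewrite gt_eqF// sqrtr_gt0 invr_gt0. Qed.

Lemma weight_gt0 (q : R) : 0 < q -> 0 < weight (p := p) q.
Proof. by move=> q0; rewrite divr_gt0// addr_gt0// prior_prec_gt0. Qed.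

(** Equal to [w_S^2 / tau_S + w_B^2 / tau_B], in the shape produced by the affine and sum rules for
    normal laws. *)
Definition noise_var : R := (- wB) ^+ 2 * prec_sd (precB p) ^+ 2 +
  (`|wS| * prec_sd (precS p)) ^+ 2.
Definition noise_sd : R := Num.sqrt noise_var.
(** The coefficient stays free: [slope] gives the variance of [G], and [1 + slope] that of
    [theta + G]. *)
Definition gap_var (c : R) : R := c ^+ 2 * prec_sd (prior_prec p) ^+ 2 + noise_sd ^+ 2.
Definition gap_mean (c : R) : R := c * mu + intercept (p := p).

Lemma noise_var_gt0 : 0 < noise_var.
Proof.
apply: ltr_wpDl; first by rewrite mulr_ge0 ?sqr_ge0.
rewrite exprn_gt0// mulr_gt0 ?normr_gt0 ?gt_eqF ?weight_gt0 ?precS_gt0//.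
by rewrite sqrtr_gt0 invr_gt0 precS_gt0.
Qed.

Lemma noise_sd_neq0 : noise_sd != 0.
Proof. by rewrite gt_eqF// sqrtr_gt0 noise_var_gt0. Qed.

Lemma gap_var_gt0 (c : R) : 0 < gap_var c.
Proof.
apply: ltr_wpDl; first by rewrite mulr_ge0 ?sqr_ge0.
by rewrite lt_neqAle sqr_ge0 andbT eq_sym sqrf_eq0 noise_sd_neq0.
Qed.

Lemma gap_sd_gt0 (c : R) : 0 < Num.sqrt (gap_var c).
Proof. by rewrite sqrtr_gt0 gap_var_gt0. Qed.

Lemma gap_sd_neq0 (c : R) : Num.sqrt (gap_var c) != 0.
Proof. by rewrite gt_eqF// gap_sd_gt0. Qed.

Lemma noise_law : has_normal_law P (noise M) (intercept (p := p)) noise_sd.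
Proof.
have mY : measurable_fun [set: T] (fun w => wS * epsS M w + intercept (p := p)).
  by apply: measurable_funD => //; exact: measurable_funM.
pose Y := real_RV P _ mY.
have lY : has_normal_law P Y (intercept (p := p)) (`|wS| * prec_sd (precS p)).
  have := has_normal_law_affine P reS 0 (prec_sd (precS p)) wS (intercept (p := p)).
  rewrite mulr0 add0r; apply; last exact: epsS_law.
    by rewrite gt_eqF// weight_gt0// precS_gt0.
  by rewrite prec_sd_neq0// precS_gt0.
have XY : independent_pair P reB Y.
  move=> A B mA mB.
  have mfB : measurable ((fun x : R => wS * x + intercept (p := p)) @^-1` B).
    by rewrite -[X in measurable X]setTI; exact: (measurable_affine wS).
  have := signal_errors_independent M _ A mfB mA.
  by rewrite setIC [RHS]muleC setIC => ->; rewrite muleC.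
have := has_normal_law_lincomb P reB Y 0 (intercept (p := p)) (prec_sd (precB p))
  (`|wS| * prec_sd (precS p)) (- wB) noise_sd.
rewrite mulr0 add0r; apply => //.
- by rewrite prec_sd_neq0// precB_gt0.
- by rewrite mulf_neq0 ?prec_sd_neq0 ?precS_gt0// normr_eq0 gt_eqF// weight_gt0// precS_gt0.
- exact: noise_sd_neq0.
- by rewrite sqr_sqrtr// ltW// noise_var_gt0.
- exact: epsB_law.
Qed.

Lemma quality_noise_law (c : R) : has_normal_law P (fun w => c * th w + noise M w)
  (gap_mean c) (Num.sqrt (gap_var c)).
Proof.
apply: (has_normal_law_lincomb P rth (noise M) mu (intercept (p := p))
  (prec_sd (prior_prec p)) noise_sd c).
- by rewrite prec_sd_neq0// prior_prec_gt0.
- exact: noise_sd_neq0.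
- exact: gap_sd_neq0.
- by rewrite sqr_sqrtr// ltW// gap_var_gt0.
- exact: quality_noise_independent.
- exact: theta_law.
- exact: noise_law.
Qed.

Local Notation c := (slope (p := p)).
Local Notation mG := (gap_mean c).
Local Notation sG := (Num.sqrt (gap_var c)).

Lemma gap_funE : gap M = (fun w => c * th w + noise M w) :> (T -> R).
Proof. exact/funext/gapE. Qed.

Lemma gap_law : has_normal_law P (gap M) mG sG.
Proof. by rewrite gap_funE; exact: quality_noise_law. Qed.

Lemma expectation_gap : ('E_P[gap M] = mG%:E)%E.
Proof. exact: (normal_law_expectation P (gap_RV M) _ _ (gap_sd_neq0 c) gap_law). Qed.

Lemma sd_gapE : sd_gap M = sG.
Proof.
rewrite /sd_gap (normal_law_variance P (gap_RV M) _ _ (gap_sd_neq0 c) gap_law)/=.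
by rewrite sqrtr_sqr ger0_norm// sqrtr_ge0.
Qed.

(* The variances of [gap] and of [theta + gap], both normal, determine the covariance. *)
Lemma covariance_gap :
  covariance P (theta M) (gap M) = (c * prec_sd (prior_prec p) ^+ 2)%:E.
Proof.
have sth0 : prec_sd (prior_prec p) != 0 by rewrite prec_sd_neq0// prior_prec_gt0.
have Lth : (th : T -> R) \in Lfun P 2%:E.
  exact: (normal_law_Lfun2 P rth mu _ sth0 (theta_law M)).
have LG : gap M \in Lfun P 2%:E.
  exact: (normal_law_Lfun2 P (gap_RV M) _ _ (gap_sd_neq0 c) gap_law).
have mD : measurable_fun [set: T] (th \+ gap M).
  by apply: measurable_funD => //; exact: measurable_gap.
pose D := real_RV P _ mD.
have lD : has_normal_law P D (gap_mean (1 + c)) (Num.sqrt (gap_var (1 + c))).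
  move=> A mA; rewrite -quality_noise_law//; congr (P _).
  have -> // : (D : T -> R) = (fun w => (1 + c) * th w + noise M w).
  by apply/funext => w; rewrite -[LHS]/(th w + gap M w) gapE (mulrDl 1 c (th w)) mul1r addrA.
have V1 := normal_law_variance P rth mu _ sth0 (theta_law M).
have V2 := normal_law_variance P (gap_RV M) _ _ (gap_sd_neq0 c) gap_law.
have V3 := normal_law_variance P D _ _ (gap_sd_neq0 (1 + c)) lD.
have Pfin : P setT \is a fin_num := fin_num_measure P _ measurableT.
have Cf : covariance P th (gap M) \is a fin_num.
  by rewrite covariance_fin_num ?Lfun2_mul_Lfun1// Lfun_subset12.
have := varianceD Lth LG.
rewrite -[X in X = _]/('V_P[D])%E -[X in _ = (X + _ + _)%E -> _]/('V_P[rth])%E.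
rewrite -[X in _ = (_ + X + _)%E -> _]/('V_P[gap_RV M])%E V1 V2 V3.
rewrite -(fineK Cf) -EFinM -!EFinD !(sqr_sqrtr (ltW (gap_var_gt0 _))) => -[e].
congr EFin; move: e; rewrite /gap_var.
move: (fine _) (prec_sd _) (noise_sd ^+ 2) => x y z e.
(* Polarization: the noise variance cancels and [(1 + c)^2 - c^2 - 1 = 2 c]. *)
have : 2 * x = 2 * (c * y ^+ 2) by lra.
by move/mulfI; apply; rewrite pnatr_eq0.
Qed.

End GapLaw.

(** * Selection bias of traded outcomes *)

Section SelectionBias.
Context {d} {T : measurableType d} {R : realType} {P : probability T R}
  {p : params R} (M : gaussian_model P p).
Local Notation leb := (@lebesgue_measure R).
Local Notation mu := (prior_mean p).
Local Notation c := (slope (p := p)).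
Local Notation mG := (gap_mean (p := p) c).
Local Notation sG := (Num.sqrt (gap_var (p := p) c)).

Let th := theta M. Let nn := nu M.
Let rth := real_RV P th (measurable_funPT th).
Let rnn := real_RV P nn (measurable_funPT nn).

Lemma measurable_trade (a : R) : measurable (trade M a).
Proof.
rewrite (_ : trade M a = gap M @^-1` `]-oo, threshold p a]%classic).
  by rewrite -[X in measurable X]setTI; exact: (measurable_gap M).
by apply/seteqP; split => w; rewrite /trade/= in_itv.
Qed.

Lemma std_thresholdE (a : R) : std_threshold M a = (threshold p a - mG) / sG.
Proof. by rewrite /std_threshold sd_gapE expectation_gap. Qed.

Lemma prob_trade (a : R) :
  P (trade M a) = normal_prob 0 1 `]-oo, std_threshold M a]%classic.
Proof.
have s0 := gap_sd_neq0 (p := p) c; have sp := gap_sd_gt0 (p := p) c.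
have := has_normal_law_affine P (gap M) mG sG sG^-1 (- (mG / sG)) _ s0 (gap_law M).
rewrite invr_eq0 s0 => /(_ isT).
have -> : sG^-1 * mG + - (mG / sG) = 0 by rewrite mulrC subrr.
have -> : `|sG^-1| * sG = 1 by rewrite gtr0_norm ?invr_gt0// mulVf.
move=> <-; last exact: measurable_itv.
congr (P _); apply/seteqP; split => w; rewrite /trade/= in_itv/= std_thresholdE;
  by rewrite mulrC -mulrBl ler_pM2r ?invr_gt0// lerD2r.
Qed.

Lemma prob_trade_gt0 (a : R) : 0 < fine (P (trade M a)).
Proof. by rewrite prob_trade normal_cdf_gt0// oner_neq0. Qed.

(** The Jacobian [sG^-1] of the standardization is the denominator in the factor
    [Cov(theta, G) / sd] of the bias. *)
Lemma gap_pdf_threshold (a : R) :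
  normal_pdf mG sG (threshold p a) = sG^-1 * normal_pdf 0 1 (std_threshold M a).
Proof.
have s0 := gap_sd_neq0 (p := p) c; have sp := gap_sd_gt0 (p := p) c.
have := normal_pdf_affine 0 1 sG mG (std_threshold M a) s0 (oner_neq0 R).
rewrite mulr0 add0r mulr1 gtr0_norm// => <-; congr normal_pdf.
by rewrite std_thresholdE mulrC divfK// subrK.
Qed.

Lemma truncated_quality (a : R) : (\int[P]_(w in trade M a) (th w - mu)%:E =
  (- (c * prec_sd (prior_prec p) ^+ 2) * normal_pdf mG sG (threshold p a))%:E)%E.
Proof.
rewrite -(truncated_normal_lincomb P rth (noise M) mu (intercept (p := p))
  (prec_sd (prior_prec p)) (noise_sd (p := p)) c sG (threshold p a)).
- by congr integral; apply/seteqP; split => w; rewrite /trade/= gapE.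
- by rewrite prec_sd_neq0// prior_prec_gt0.
- exact: noise_sd_neq0.
- exact: gap_sd_neq0.
- by rewrite (sqr_sqrtr (ltW (gap_var_gt0 _))).
- exact: quality_noise_independent.
- exact: theta_law.
- exact: noise_law.
Qed.

(** Obtained from the truncated mean formula with [X = nu], [Y = G] and [c = 0], whose right-hand
    side vanishes. *)
Lemma truncated_outcome_noise (a : R) :
  (\int[P]_(w in trade M a) (nn w)%:E = 0)%E.
Proof.
transitivity ((- (0 * prec_sd (precz p) ^+ 2) *
    normal_pdf (0 * 0 + mG) sG (threshold p a))%:E)%E; last first.
  by rewrite mul0r oppr0 mul0r.
rewrite -(truncated_normal_lincomb P rnn (gap_RV M) 0 mG
  (prec_sd (precz p)) sG 0 sG (threshold p a)).
- rewrite (_ : [set w | _] = trade M a).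
    by apply: eq_integral => w _; rewrite subr0.
  by apply/seteqP; split => w; rewrite /trade/= mul0r add0r.
- by rewrite prec_sd_neq0// precz_gt0.
- exact: gap_sd_neq0.
- exact: gap_sd_neq0.
- by rewrite expr0n mul0r add0r.
- exact: outcome_gap_independent.
- exact: nu_law.
- exact: gap_law.
Qed.

Lemma selection_biasE (a : R) : selection_bias M a =
  - (c * prec_sd (prior_prec p) ^+ 2 / sG) * mills (std_threshold M a).
Proof. by rewrite /selection_bias covariance_gap sd_gapE. Qed.

(** Common source of the outcome bias and of both unselected update errors, each affine in
    [theta - mu] and [nu]; only the coefficient of quality survives. *)
Lemma event_expectation_trade_linear (X : T -> R) (e f a : R) :
  (forall w, X w = e * (th w - mu) + f * nn w) ->
  event_expectation P (trade M a) X = (e * selection_bias M a)%:E.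
Proof.
move=> XE; rewrite /event_expectation.
have mA := measurable_trade a.
have sth0 : prec_sd (prior_prec p) != 0 by rewrite prec_sd_neq0// prior_prec_gt0.
have szn0 : prec_sd (precz p) != 0 by rewrite prec_sd_neq0// precz_gt0.
have [ith _] := normal_law_mean P rth mu _ sth0 (theta_law M).
have [inn _] := normal_law_mean P rnn 0 _ szn0 (nu_law M).
have ithm : P.-integrable (trade M a) (fun w => (th w - mu)%:E).
  apply: (integrableS measurableT) => //.
  under eq_fun do rewrite EFinB.
  by apply: integrableB => //; exact: finite_measure_integrable_cst.
have innm : P.-integrable (trade M a) (fun w => (nn w)%:E).
  exact: (integrableS measurableT).
have -> : (\int[P]_(w in trade M a) (X w)%:E =
  \int[P]_(w in trade M a) (e%:E * (th w - mu)%:E + f%:E * (nn w)%:E))%E.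
  by apply: eq_integral => w _; rewrite XE EFinD !EFinM.
rewrite integralD//; [|exact: integrableZl|exact: integrableZl].
rewrite !integralZl// truncated_quality truncated_outcome_noise mule0 adde0.
rewrite -!EFinM selection_biasE gap_pdf_threshold prob_trade /mills; congr EFin.
ring.
Qed.

Lemma slope_neq0 : precS p <> precB p -> c != 0.
Proof.
move=> pSB; have t0 := prior_prec_gt0 p; have S0 := precS_gt0 p; have B0 := precB_gt0 p.
have -> : c = prior_prec p * (precS p - precB p) /
    ((prior_prec p + precS p) * (prior_prec p + precB p)).
  by rewrite /slope /weight; field; rewrite !gt_eqF// addr_gt0.
apply: mulf_neq0; last by rewrite invr_neq0// mulf_neq0 ?gt_eqF ?addr_gt0.
by apply: mulf_neq0; [rewrite gt_eqF|rewrite subr_eq0; exact/eqP].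
Qed.

Lemma selection_bias_slope0 (a : R) : precS p = precB p -> selection_bias M a = 0.
Proof. by move=> SB; rewrite selection_biasE /slope SB subrr !mul0r oppr0 mul0r. Qed.

Lemma mills_gt0 (k : R) : 0 < mills k.
Proof. by rewrite divr_gt0 ?normal_pdf_gt0 ?normal_cdf_gt0 ?oner_neq0. Qed.

Lemma selection_bias_factor_gt0 : precS p <> precB p ->
  0 < `|- (c * prec_sd (prior_prec p) ^+ 2 / sG)|.
Proof.
move=> pSB; rewrite normr_gt0 oppr_eq0 mulf_neq0 ?invr_eq0 ?gap_sd_neq0//.
by rewrite mulf_neq0 ?slope_neq0// expf_eq0/= prec_sd_neq0// prior_prec_gt0.
Qed.

Lemma selection_bias_neq0 (a : R) : precS p <> precB p -> selection_bias M a != 0.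
Proof.
move=> pSB; rewrite selection_biasE; apply: mulf_neq0.
  by rewrite -normr_gt0 selection_bias_factor_gt0.
by rewrite gt_eqF// mills_gt0.
Qed.

(** The factor before the Mills ratio does not involve [a], and a larger [a] lowers the standardized
    threshold. *)
Lemma selection_bias_increasing (a1 a2 : R) : precS p <> precB p -> a1 < a2 ->
  `|selection_bias M a1| < `|selection_bias M a2|.
Proof.
move=> pSB a12; rewrite !selection_biasE !(normrM (- _)) ltr_pM2l ?selection_bias_factor_gt0//.
rewrite !(gtr0_norm (mills_gt0 _)); apply: mills_decreasing; rewrite !std_thresholdE.
rewrite ltr_pM2r ?invr_gt0 ?gap_sd_gt0// ltrD2r /threshold.
by rewrite ltrD2r ltrD2l ltrN2.
Qed.

End SelectionBias.

(** * Posterior mean under the trading rule *)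

Section Conditioning.
Context {d} {T : measurableType d} {R : realType} {P : probability T R}
  {p : params R} (M : gaussian_model P p) (a : R).
Local Notation leb := (@lebesgue_measure R).
Local Notation mu := (prior_mean p).

Let th := theta M. Let nn := nu M.
Let rth := real_RV P th (measurable_funPT th).
Let rnn := real_RV P nn (measurable_funPT nn).
Let c : R := slope (p := p).
Let sth := prec_sd (prior_prec p).
Let szn := prec_sd (precz p).
Let Q := trade_prob_at M a.

Lemma trade_prob_atE (t : R) : Q t =
  fine (normal_prob (intercept (p := p)) (noise_sd (p := p))
    `]-oo, threshold p a - c * t]%classic).
Proof.
rewrite -(noise_law M); last exact: measurable_itv.
congr (fine (P _)); apply/seteqP; split => w;
  rewrite /preimage/= in_itv/= mean_gap_affine /c => h; lra.
Qed.

Lemma trade_prob_at_gt0 (t : R) : 0 < Q t.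
Proof. by rewrite trade_prob_atE normal_cdf_gt0// noise_sd_neq0. Qed.

Lemma trade_prob_at_le1 (t : R) : Q t <= 1.
Proof.
rewrite trade_prob_atE -lee_fin fineK ?probability_le1//.
by rewrite fin_num_measure.
Qed.

Let E : set (R * R) := [set z | c * z.1 + z.2 <= threshold p a].

Let mE : measurable E.
Proof.
pose f (z : R * R) := c * z.1 + z.2.
have mf : measurable_fun [set: R * R] f by apply: measurable_funD => //; exact: measurable_funM.
rewrite (_ : E = f @^-1` `]-oo, threshold p a]%classic).
  by rewrite -[X in measurable X]setTI; exact: mf.
by apply/seteqP; split => z; rewrite /preimage/= in_itv.
Qed.

(** Written as a section integral, [Q] becomes measurable by Tonelli. *)
Lemma trade_prob_at_section (t : R) :
  (\int[distribution P (noise M)]_y (\1_E (t, y))%:E = (Q t)%:E)%E.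
Proof.
have mB : measurable (xsection E t) by exact: measurable_xsection.
transitivity (\int[distribution P (noise M)]_y (\1_(xsection E t) y)%:E)%E.
  by apply: eq_integral => y _; rewrite !indicE mem_xsection.
rewrite integral_indic// setIT.
have mN : measurable (noise M @^-1` xsection E t).
  by rewrite -[X in measurable X]setTI; exact: (measurable_funPT (noise M)).
transitivity ((fine (P (noise M @^-1` xsection E t)))%:E).
  by rewrite fineK// fin_num_measure.
congr (fine (P _))%:E; apply/seteqP.
by split => w; rewrite /preimage /xsection/= inE /E/= mean_gap_affine.
Qed.

Lemma measurable_trade_prob_at : measurable_fun [set: R] Q.
Proof.
have mI : measurable_fun [set: R * R] (fun z => (\1_E z)%:E : \bar R).
  by apply/measurable_EFinP; exact: measurable_indic.
have I0 z : (0 <= (\1_E z)%:E :> \bar R)%E by rewrite lee_fin.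
have H := @measurable_fun_fubini_tonelli_F _ _ _ _ R (distribution P (noise M)) _ mI I0.
apply/measurable_EFinP; rewrite (_ : EFin \o Q =
  fubini_F (distribution P (noise M)) (fun z : R * R => (\1_E z)%:E : \bar R))//.
by apply/funext => t; rewrite /fubini_F trade_prob_at_section.
Qed.

(* Given [theta], the trading event depends only on the signal errors, which
   are independent of [(theta, nu)]: it may be replaced by its probability. *)
Lemma ge0_integral_trade (G : R * R -> \bar R) : measurable_fun [set: R * R] G ->
  (forall z, 0 <= G z)%E ->
  (\int[P]_w (G (th w, outcome M w) * (\1_(trade M a) w)%:E) =
   \int[leb \x leb]_z (G z *
     (normal_pdf mu sth z.1 * normal_pdf 0 szn (z.2 - 1 * z.1) * Q z.1)%:E))%E.
Proof.
move=> mG G0.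
pose V := pair_RV P rth rnn.
pose H (v : (R * R) * R) : \bar R :=
  (G (v.1.1, 1 * v.1.1 + v.1.2)%R * (\1_E (v.1.1, v.2))%:E)%E.
have mG1 : measurable_fun [set: R * R] (fun z : R * R => G (z.1, 1 * z.1 + z.2)%R).
  apply: (measurableT_comp mG); apply: measurable_fun_pair => //.
  by apply: measurable_funD => //; exact: measurable_funM.
have mH : measurable_fun [set: (R * R) * R] H.
  apply: emeasurable_funM; first exact: (measurableT_comp mG1 measurable_fst).
  apply/measurable_EFinP.
  apply: (measurableT_comp (@measurable_indic _ _ R setT E mE)).
  apply: measurable_fun_pair => //.
  exact: (measurableT_comp measurable_fst measurable_fst).
have H0 v : (0 <= H v)%E by rewrite mule_ge0.
transitivity (\int[P]_w H (V w, noise M w))%E.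
  apply: eq_integral => w _; rewrite /H/= mul1r; congr (_ * _%:E)%E.
  rewrite !indicE; congr ((_ : bool)%:R).
  by apply/idP/idP => /set_mem h; apply: mem_set; move: h; rewrite /trade /E/= gapE.
rewrite (ge0_integral_independent P V (noise M) H (pair_noise_independent M))//.
pose G1 (z : R * R) : \bar R := (G z * (Q z.1)%:E)%E.
have mQ := measurable_trade_prob_at.
have mG2 : measurable_fun [set: R * R] G1.
  apply: emeasurable_funM => //; apply/measurable_EFinP.
  exact: (measurableT_comp mQ measurable_fst).
have Q0 t : 0 <= Q t by rewrite ltW// trade_prob_at_gt0.
have G10 z : (0 <= G1 z)%E by rewrite mule_ge0// lee_fin.
transitivity (\int[distribution P V]_v G1 (v.1, 1 * v.1 + v.2)%R)%E.
  apply: eq_integral => v _; rewrite /H/=.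
  have mI : measurable_fun [set: R] (fun y : R => (\1_E (v.1, y))%:E : \bar R).
    apply/measurable_EFinP; apply: (measurableT_comp (@measurable_indic _ _ R setT E mE)).
    exact: measurable_fun_pair.
  have I0 (y : R) : [set: R] y -> (0 <= (\1_E (v.1, y))%:E :> \bar R)%E.
    by rewrite lee_fin.
  have Gv : (0 <= G (v.1, 1 * v.1 + v.2)%R)%E by exact: G0.
  rewrite (@ge0_integralZl _ (measurableTypeR R) R (distribution P (noise M)) setT
    measurableT _ mI _ I0 Gv).
  by rewrite trade_prob_at_section.
rewrite ge0_integral_distribution//; last first.
  apply: (measurableT_comp mG2); apply: measurable_fun_pair => //.
  by apply: measurable_funD => //; exact: measurable_funM.
have := ge0_integral_sheared_normal P rth rnn mu 0 sth szn 1 G1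
  (quality_outcome_independent M) (theta_law M) (nu_law M) mG2 G10.
move=> e; transitivity (\int[P]_w G1 (rth w, 1 * rth w + rnn w)%R)%E => //.
rewrite e; apply: eq_integral => z _.
by rewrite /G1 -muleA -EFinM mulrC.
Qed.


(** Unnormalized density of [(theta, z)] on trade; [1 *] is the shear coefficient, as
    [z = theta + nu]. *)
Let j (z : R * R) : R := normal_pdf mu sth z.1 * normal_pdf 0 szn (z.2 - 1 * z.1) * Q z.1.

Let s0 : sth != 0. Proof. by rewrite prec_sd_neq0// prior_prec_gt0. Qed.
Let n0 : szn != 0. Proof. by rewrite prec_sd_neq0// precz_gt0. Qed.
Lemma selected_jointE (t z : R) :
  selected_joint M a t z = j (t, z) * (fine (P (trade M a)))^-1.
Proof.
have e : normal_pdf t szn z = normal_pdf 0 szn (z - 1 * t).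
  by rewrite mul1r -(normal_pdf_center t szn _ n0) subrK.
by rewrite /j/= -e; congr (_ / _); exact: mulrAC.
Qed.

Lemma selected_joint_gt0 (t z : R) : 0 < selected_joint M a t z.
Proof.
rewrite selected_jointE mulr_gt0 ?invr_gt0 ?prob_trade_gt0//.
by rewrite !mulr_gt0 ?normal_pdf_gt0 ?trade_prob_at_gt0.
Qed.

Let jd (z : R * R) : R := selected_joint M a z.1 z.2.

Let mjd : measurable_fun [set: R * R] jd.
Proof.
rewrite (_ : jd = fun z => j z * (fine (P (trade M a)))^-1); last first.
  by apply/funext => -[t z]; exact: selected_jointE.
apply: measurable_funM => //; apply: measurable_funM.
  apply: measurable_funM.
    exact: (measurableT_comp (measurable_normal_pdf _ _) measurable_fst).
  apply: (measurableT_comp (measurable_normal_pdf 0 szn)); apply: measurable_funB => //.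
  exact: measurable_funM.
exact: (measurableT_comp measurable_trade_prob_at measurable_fst).
Qed.

Let K (z : R) : R := normal_pdf mu (Num.sqrt ((prior_prec p)^-1 + (precz p)^-1)) z *
  (fine (P (trade M a)))^-1.
Let pm (z : R) : R := (prior_prec p * mu + precz p * z) / (prior_prec p + precz p).
Let ps : R := Num.sqrt (prior_prec p + precz p)^-1.

(** In [t], the selected density is the conjugate posterior tilted by the probability of trade. *)
Let jdE (t z : R) : jd (t, z) = K z * (normal_pdf (pm z) ps t * Q t).
Proof.
have e := normal_pdf_conjugate mu _ _ z t (prior_prec_gt0 p) (precz_gt0 p).
rewrite -[LHS]/(prior_pdf p t * Q t * outcome_pdf p t z / fine (P (trade M a))).
rewrite (mulrAC (prior_pdf p t)) [X in X * _ / _]e -/(pm z) -/ps /K.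
by rewrite -!mulrA; congr (_ * _); rewrite mulrA mulrC.
Qed.

Let K0 z : 0 <= K z.
Proof. by rewrite mulr_ge0 ?normal_pdf_ge0// invr_ge0 ltW// prob_trade_gt0. Qed.
Let Q0 t : 0 <= Q t. Proof. by rewrite ltW// trade_prob_at_gt0. Qed.
Let ps0 : ps != 0.
Proof. by rewrite gt_eqF// sqrtr_gt0 invr_gt0 addr_gt0 ?prior_prec_gt0 ?precz_gt0. Qed.

(** Since [Q <= 1], the selected density is at most [K z] times the conjugate normal density. *)
Let dominated (z : R) (k : R -> R) : measurable_fun [set: R] k ->
  leb.-integrable [set: R] (fun t : R => (k t * normal_pdf (pm z) ps t)%:E) ->
  leb.-integrable [set: R] (fun t : R => (k t * jd (t, z))%:E).
Proof.
move=> mk ik.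
have iK := @integrableZl _ _ _ leb _ measurableT (K z) _ ik.
apply: le_integrable iK => //.
  apply/measurable_EFinP; apply: measurable_funM => //.
  exact: (measurableT_comp mjd (measurable_pair2 z)).
move=> t _; rewrite /= lee_fin jdE mulrCA mulrA.
rewrite normrM mulrA [leRHS]normrM -!normrM mulrA normrM ler_piMr// ger0_norm//.
exact: trade_prob_at_le1.
Qed.

Lemma integrable_selected_joint (z : R) :
  leb.-integrable [set: R] (fun t : R => (selected_joint M a t z)%:E).
Proof.
have : leb.-integrable [set: R] (fun t : R => (1 * jd (t, z))%:E).
  apply: (dominated z (fun=> 1)) => //.
  under eq_fun do rewrite mul1r; exact: integrable_normal_pdf.
by under eq_fun do rewrite mul1r.
Qed.

Lemma integrable_selected_joint_moment (z : R) :
  leb.-integrable [set: R] (fun t : R => (t * selected_joint M a t z)%:E).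
Proof. by apply: (dominated z (fun t => t)) => //; exact: (integral_normal_mean _ _ ps0).1. Qed.

Let u := bayes_mean (selected_joint M a).

Let C : R := fine (P (trade M a)).
Let C0 : C != 0. Proof. by rewrite gt_eqF// prob_trade_gt0. Qed.

Let j0 z : 0 <= j z.
Proof. by rewrite mulr_ge0// mulr_ge0 ?normal_pdf_ge0. Qed.

Let jd0 z : 0 <= jd z. Proof. by rewrite ltW// selected_joint_gt0. Qed.

Let jdj z : jd z = j z * C^-1.
Proof. by case: z => t z; exact: selected_jointE. Qed.

(** Back on the probability space, the absolute moment is [E|theta|] restricted to trade and divided
    by [P(trade)], hence finite. *)
Lemma integrable_selected_quality :
  (leb \x leb)%E.-integrable [set: R * R] (fun z : R * R => (z.1 * jd z)%:E).
Proof.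
have [ith _] := normal_law_mean P rth mu sth s0 (theta_law M).
have iC := integrableZl measurableT C^-1 ith.
pose G (z : R * R) : \bar R := (`|C^-1 * z.1|)%:E.
have mG : measurable_fun [set: R * R] G.
  apply: (measurableT_comp (@EFin_measurable R setT)).
  apply: (measurableT_comp (@normr_measurable R setT)).
  by apply: measurable_funM => //; exact: measurable_fst.
have G0 z : (0 <= G z)%E by rewrite lee_fin.
apply/integrableP; split; first exact/measurable_EFinP/measurable_funM.
have /integrableP[_] := iC; apply: le_lt_trans.
have -> : (\int[leb \x leb]_z `|(z.1 * jd z)%:E| = \int[leb \x leb]_z (G z * (j z)%:E))%E.
  apply: eq_integral => z _; rewrite /G -EFinM /= jdj.
  rewrite (normrM z.1) (normrM (j z)) (normrM C^-1) (ger0_norm (j0 z)).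
  by congr EFin; ring.
rewrite -(ge0_integral_trade G mG G0); apply: ge0_le_integral => //.
- by move=> w _; rewrite mule_ge0// lee_fin.
- apply: emeasurable_funM; last first.
    by apply/measurable_EFinP/measurable_indic; exact: measurable_trade.
  apply: (measurableT_comp mG); apply: measurable_fun_pair => //.
  by apply: measurable_funD.
- by apply: measurableT_comp => //; exact: (measurable_int _ iC).
by move=> w _; rewrite /G -EFinM /= lee_fin ler_piMr.
Qed.

Let measurable_u : measurable_fun [set: R] u.
Proof.
have mjE : measurable_fun [set: R * R] (fun z => (jd z)%:E) by exact/measurable_EFinP.
have jdE0 z : (0 <= (jd z)%:E :> \bar R)%E by rewrite lee_fin.
have m1 := @measurable_fun_fubini_tonelli_G _ _ _ _ R leb _ mjE jdE0.
have m2 := @measurable_fubini_G _ _ _ _ R leb leb _ integrable_selected_quality.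
have mf := @fine_measurable R setT measurableT.
rewrite (_ : u = fun z => (fine (fubini_G leb (fun z => (jd z)%:E) z))^-1 *
    fine (fubini_G leb (fun z => (z.1 * jd z)%:E) z)).
  apply: measurable_funM; last exact: (measurableT_comp mf m2).
  (* Inversion is handled as the measurable power [-1], which agrees with it on nonnegative
     values. *)
  rewrite (_ : (fun z => _) = (fun z => (fine (fubini_G leb (fun z => (jd z)%:E) z)) `^ (-1))).
    exact: (measurableT_comp (measurable_powR _) (measurableT_comp mf m1)).
  apply/funext => z; rewrite powR_inv1//; apply: fine_ge0.
  by apply: integral_ge0 => t _; rewrite lee_fin.
apply/funext => z; rewrite /u bayes_mean_ratio//.
exact: integrable_selected_joint_moment.
Qed.

Lemma expected_update_error_selected : expected_update_error M a u = 0%E.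
Proof.
rewrite /expected_update_error /event_expectation.
pose F (z : R * R) := u z.2 - z.1.
have mF : measurable_fun [set: R * R] F.
  exact: (measurable_funB (measurableT_comp measurable_u measurable_snd) measurable_fst).
have i0 (w : T) : 0 <= (\1_(trade M a) w : R) by rewrite indicE; exact: ler0n.
rewrite integral_mkcond.
have -> : (\int[P]_w ((fun w => (u (outcome M w) - th w)%:E) \_ (trade M a)) w =
    \int[P]_w (F (th w, outcome M w) * \1_(trade M a) w)%:E)%E.
  apply: eq_integral => w _; rewrite patchE indicE.
  by case: (_ \in _); rewrite ?mulr1// mulr0.
rewrite (integral_transfer _ _ _ _ _ P (leb \x leb)%E (fun w => (th w, outcome M w))
  (\1_(trade M a)) j i0 j0 ge0_integral_trade F mF).
(* The factor [- C] undoes the division by the probability of trade and the sign, the general lemma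
   being about quality minus estimate. *)
have -> : (\int[leb \x leb]_z (F z * j z)%:E =
    \int[leb \x leb]_z ((- C)%:E * ((z.1 - u z.2) * jd z)%:E))%E.
  apply: eq_integral => z _; rewrite -EFinM jdj; congr EFin; rewrite /F.
  by field.
have uE z : ((u z)%:E * \int[leb]_t (jd (t, z))%:E =
    \int[leb]_t (t * jd (t, z))%:E)%E.
  apply: bayes_meanE; first by move=> t; exact: selected_joint_gt0.
    exact: integrable_selected_joint.
  exact: integrable_selected_joint_moment.
have [ierr err0] := integral_conditional_mean_error jd u mjd measurable_u jd0
  integrable_selected_joint integrable_selected_quality uE.
by rewrite (integralZl measurableT ierr) err0 mule0 mul0e.
Qed.

End Conditioning.

Theorem proposition4 (d : measure_display) (T : measurableType d)
    (R : realType) (P : probability T R) (p : params R)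
    (M : gaussian_model P p) :
  (* unequal private-signal precisions *)
  (precS p <> precB p ->
    [/\ (forall a : R, 0 <= a ->
          event_expectation P (trade M a)
            (fun w => outcome M w - prior_mean p) = (selection_bias M a)%:E),
        (forall a1 a2 : R, 0 <= a1 -> a1 < a2 ->
          `|selection_bias M a1| < `|selection_bias M a2|) &
        (forall a : R, 0 <= a ->
          expected_update_error M a (bayes_mean (unselected_joint p))
            <> 0%E /\
          event_expectation P (trade M a)
            (fun w => bayes_mean (unselected_joint p) (outcome M w)
                      - prior_mean p) <> 0%E)]) /\
  (* symmetric benchmark *)
  (precS p = precB p ->
    forall a : R, 0 <= a ->
      selection_bias M a = 0 /\
      event_expectation P (trade M a)
        (fun w => outcome M w - prior_mean p) = 0%E) /\
  (* the unselected likelihood yields the conjugate update *)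
  (forall z t : R,
    bayes_pdf (unselected_joint p) z t =
    normal_pdf ((prior_prec p * prior_mean p + precz p * z)
                  / (prior_prec p + precz p))
               (Num.sqrt (prior_prec p + precz p)^-1) t) /\
  (* conditioning on the trading rule removes the error *)
  (forall a : R, 0 <= a ->
    expected_update_error M a (bayes_mean (selected_joint M a)) = 0%E).
Proof.
have t0 := prior_prec_gt0 p; have z0 := precz_gt0 p.
have tz0 : prior_prec p + precz p != 0 by rewrite gt_eqF// addr_gt0.
have traded_outcome a : event_expectation P (trade M a)
    (fun w => outcome M w - prior_mean p) = (selection_bias M a)%:E.
  rewrite (event_expectation_trade_linear M _ 1 1) ?mul1r// => w.
  by rewrite /outcome; ring.
split; [|split; [|split]].
- move=> pSB; split => [a _ | a1 a2 _ a12 | a _].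
  + exact: traded_outcome.
  + exact: selection_bias_increasing.
  + have b0 := selection_bias_neq0 M a pSB.
    split.
      (* The estimate minus [theta] shrinks [theta - mu] by [- tau / (tau + tau_z)] and loads
         [tau_z / (tau + tau_z)] on [nu]. *)
      rewrite /expected_update_error (event_expectation_trade_linear M _
        (- (prior_prec p / (prior_prec p + precz p)))
        (precz p / (prior_prec p + precz p))).
        move=> [] /eqP; apply/negP; apply: mulf_neq0 => //.
        by rewrite oppr_eq0 mulf_neq0 ?invr_neq0// gt_eqF.
      by move=> w; rewrite bayes_mean_unselected /outcome; field.
    (* Measured from the prior mean, the update is [tau_z / (tau + tau_z)] times [z - mu]. *)
    rewrite (event_expectation_trade_linear M _
      (precz p / (prior_prec p + precz p)) (precz p / (prior_prec p + precz p))).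
      move=> [] /eqP; apply/negP; apply: mulf_neq0 => //.
      by rewrite mulf_neq0 ?invr_neq0// gt_eqF.
    by move=> w; rewrite bayes_mean_unselected /outcome; field.
- move=> SB a _; have b0 := selection_bias_slope0 M a SB.
  by split => //; rewrite traded_outcome b0.
- exact: bayes_pdf_unselected.
- by move=> a _; exact: expected_update_error_selected.
Qed.
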